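(* Let $n\ge2$. An arc-length parametrized curve $\gamma\in C^\infty([a,b];\mathbb{R}^n)$ with bending stiffness $\varrho\in C^\infty([a,b];\mathbb{R}_{>0})$ is elastic with bending stiffness $\varrho$ if and only if its curvature function $\kappa\in C^\infty([a,b];\mathbb{R}^{n-1})$ satisfies $$\begin{cases}0=(\varrho\kappa)''+\tfrac12\varrho\langle\kappa,\kappa\rangle\kappa-\Lambda\kappa,\\ 0=\Lambda'+\tfrac12\varrho'\langle\kappa,\kappa\rangle\end{cases}$$ for some $\Lambda\in C^\infty([a,b];\mathbb{R})$.
   Context: A curve is a map $\gamma\in C^\infty([a,b];\mathbb{R}^n)$ with $\gamma'\ne0$ everywhere; it is arc-length parametrized if $|\gamma'|\equiv1$. For a function $g$ along $\gamma$, $\frac{dg}{ds}:=g'/|\gamma'|$ and $ds=|\gamma'|\,dx$; $T:=\frac{d\gamma}{ds}$. The bending energy of $\gamma$ with bending stiffness $\varrho\in C^\infty([a,b];\mathbb{R}_{>0})$ is $\mathcal B_\varrho(\gamma):=\frac12\int_a^b\varrho\,\langle\frac{dT}{ds},\frac{dT}{ds}\rangle\,ds$ ($\varrho$ is a fixed function on $[a,b]$, not varied). A smooth variation of $\gamma$ is a smooth one-parameter family $\gamma_t$, $t\in[-\epsilon,\epsilon]$, with $\gamma_0=\gamma$; its variational vector field is $\mathring\gamma:=\frac{d}{dt}|_{t=0}\gamma_t$, and for a functional $\mathcal F$, $d\mathcal F(\mathring\gamma):=\frac{d}{dt}|_{t=0}\mathcal F(\gamma_t)$. $C_0^\infty([a,b];\mathbb{R}^n)$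 denotes the smooth maps with compact support in the interior of $[a,b]$. Variations and variational vector fields are treated as synonyms. An arc-length parametrized curve $\gamma$ with bending stiffness $\varrho$ is called elastic with bending stiffness $\varrho$ if it is a critical point of $\mathcal B_\varrho$ under all variations $\mathring\gamma\in C_0^\infty([a,b];\mathbb{R}^n)$ constraining the arc-length, i.e. $d\mathcal B_\varrho(\mathring\gamma)=0$ for all $\mathring\gamma\in C_0^\infty([a,b];\mathbb{R}^n)$ satisfying pointwise $\langle\mathring\gamma',\gamma'\rangle=0$. Curvature function: a normal field $Z$ along $\gamma$ is parallel if $Z'=\lambda T$ for some smooth function $\lambda$. Let $N=[N_1,\dots,N_{n-1}]$ be made of parallel unit normal fields along $\gamma$ with $\det(T,N_1,\dots,N_{n-1})=1$. The curvature function $\kappa\in C^\infty([a,b];\mathbb{R}^{n-1})$ of the arc-length parametrized curve $\gamma$ (with respect to such a fixed choice of $N$) is defined by $T'=-N\kappa$. *)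

(* Defs.v *)
From HB Require Import structures.
From mathcomp Require Import all_boot all_order all_algebra.
From mathcomp Require Import all_classical all_reals all_analysis.

Set Implicit Arguments.
Unset Strict Implicit.
Unset Printing Implicit Defensive.

Import Order.TTheory GRing.Theory Num.Theory.
Import numFieldNormedType.Exports.

Local Open Scope classical_set_scope.
Local Open Scope ring_scope.

(* The norm which the library puts on matrices is the sup norm; the Euclidean
   structure of R^n is therefore introduced separately. *)
Definition dotv (R : realType) (n : nat) (u v : 'cV[R]_n) : R :=
  \sum_(i < n) u i 0 * v i 0.

Definition enorm (R : realType) (n : nat) (u : 'cV[R]_n) : R :=
  Num.sqrt (dotv u u).

(* A smooth map on the closed interval [a, b] is a total function on R which is
   C^oo on some open set containing [a, b], i.e. we work with a representative
   of the map that is a smooth extension of it. All the conditions below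
   constrain the functions on [a, b] only, and values and derivatives on [a, b]
   (endpoints included) do not depend on the chosen extension. *)
Definition smooth_on (R : realType) (V : normedModType R) (A : set R)
    (f : R -> V) : Prop :=
  exists U : set R, [/\ open U, A `<=` U &
    forall (k : nat) (x : R), U x -> derivable (derive1n k f) x 1].

(* [iter_partial s F] is the iterated partial derivative of F : (t, x) |-> F t x
   along the word s, true standing for d/dt and false for d/dx; the head of s is
   the last derivative taken. *)
Fixpoint iter_partial (R : realType) (V : normedModType R) (s : seq bool)
    (F : R -> R -> V) : R -> R -> V :=
  match s with
  | [::] => F
  | true :: s' => fun t x => derive1 (fun u => iter_partial s' F u x) t
  | false :: s' => fun t x => derive1 (iter_partial s' F t) x
  end.

Definition smooth2_on (R : realType) (V : normedModType R) (A : set (R * R))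
    (F : R -> R -> V) : Prop :=
  exists U : set (R * R), [/\ open U, A `<=` U &
    forall (s : seq bool) (p : R * R), U p ->
      let H := iter_partial s F in
      [/\ {for p, continuous (fun q : R * R => H q.1 q.2)},
          derivable (fun t => H t p.2) p.1 1 &
          derivable (H p.1) p.2 1]].

(* C_0^oo([a, b]; V), each map being extended by 0 outside [a, b]. *)
Definition smooth_compact_support (R : realType) (V : normedModType R)
    (a b : R) (w : R -> V) : Prop :=
  let supp := closure [set x | w x != 0] in
  [/\ forall (k : nat) (x : R), derivable (derive1n k w) x 1,
      compact supp & supp `<=` `]a, b[].

Definition is_curve (R : realType) (n : nat) (a b : R) (g : R -> 'cV[R]_n) :
    Prop :=
  smooth_on `[a, b] g /\ forall x, x \in `[a, b] -> derive1 g x != 0.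

Definition arclength_parametrized (R : realType) (n : nat) (a b : R)
    (g : R -> 'cV[R]_n) : Prop :=
  is_curve a b g /\ forall x, x \in `[a, b] -> enorm (derive1 g x) = 1.

(* dds g h = dh/ds for a field h along the curve g *)
Definition dds (R : realType) (n m : nat) (g : R -> 'cV[R]_n)
    (h : R -> 'cV[R]_m) : R -> 'cV[R]_m :=
  fun x => (enorm (derive1 g x))^-1 *: derive1 h x.

Definition tangent (R : realType) (n : nat) (g : R -> 'cV[R]_n) :
    R -> 'cV[R]_n :=
  dds g g.

Definition stiffness (R : realType) (a b : R) (rho : R -> R) : Prop :=
  smooth_on `[a, b] rho /\ forall x, x \in `[a, b] -> 0 < rho x.

Definition bending_energy (R : realType) (n : nat) (a b : R) (rho : R -> R)
    (g : R -> 'cV[R]_n) : R :=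
  2^-1 * \int[@lebesgue_measure R]_(x in `[a, b])
    (rho x * dotv (dds g (tangent g) x) (dds g (tangent g) x)
       * enorm (derive1 g x)).

(* [G t] is the curve g_t of the family, for t in [-eps, eps]. *)
Definition smooth_variation (R : realType) (n : nat) (a b : R)
    (g : R -> 'cV[R]_n) (eps : R) (G : R -> R -> 'cV[R]_n) : Prop :=
  [/\ 0 < eps,
      smooth2_on (`[- eps, eps] `*` `[a, b]) G,
      forall t, t \in `[- eps, eps] -> is_curve a b (G t) &
      forall x, x \in `[a, b] -> G 0 x = g x].

Definition variational_field (R : realType) (n : nat)
    (G : R -> R -> 'cV[R]_n) : R -> 'cV[R]_n :=
  fun x => derive1 (fun t => G t x) 0.

(* The condition dB(w) = 0 is required along every smooth variation with
   variational vector field w, and includes the existence of the derivative. *)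
Definition elastic (R : realType) (n : nat) (a b : R) (rho : R -> R)
    (g : R -> 'cV[R]_n) : Prop :=
  forall w : R -> 'cV[R]_n,
    smooth_compact_support a b w ->
    (forall x, x \in `[a, b] -> dotv (derive1 w x) (derive1 g x) = 0) ->
  forall (eps : R) (G : R -> R -> 'cV[R]_n),
    smooth_variation a b g eps G ->
    (forall x, x \in `[a, b] -> variational_field G x = w x) ->
  is_derive (0 : R) 1 (fun t : R => bending_energy a b rho (G t)) 0.

Definition normal_field (R : realType) (n : nat) (a b : R)
    (g Z : R -> 'cV[R]_n) : Prop :=
  smooth_on `[a, b] Z /\
  forall x, x \in `[a, b] -> dotv (Z x) (tangent g x) = 0.

Definition parallel_field (R : realType) (n : nat) (a b : R)
    (g Z : R -> 'cV[R]_n) : Prop :=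
  normal_field a b g Z /\
  exists2 lambda : R -> R, smooth_on `[a, b] lambda &
    forall x, x \in `[a, b] -> derive1 Z x = lambda x *: tangent g x.

(* The columns of N x are the values at x of the normal fields. *)
Definition parallel_frame (R : realType) (m : nat) (a b : R)
    (g : R -> 'cV[R]_m.+1) (N : R -> 'M[R]_(m.+1, m)) : Prop :=
  [/\ forall j : 'I_m, parallel_field a b g (fun x => col j (N x)),
      forall (j : 'I_m) x, x \in `[a, b] -> enorm (col j (N x)) = 1 &
      forall x, x \in `[a, b] ->
        \det (row_mx (tangent g x) (N x) : 'M[R]_m.+1) = 1].

Definition curvature_function (R : realType) (m : nat) (a b : R)
    (g : R -> 'cV[R]_m.+1) (N : R -> 'M[R]_(m.+1, m)) (kappa : R -> 'cV[R]_m) :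
    Prop :=
  smooth_on `[a, b] kappa /\
  forall x, x \in `[a, b] -> derive1 (tangent g) x = - (N x *m kappa x).

(* Main.v *)
Require Import Defs.
From HB Require Import structures.
From mathcomp Require Import all_boot all_order all_algebra.
From mathcomp Require Import all_classical all_reals all_analysis.
From mathcomp Require Import ring.

Set Implicit Arguments.
Unset Strict Implicit.
Unset Printing Implicit Defensive.

Import Order.TTheory GRing.Theory Num.Theory.
Import numFieldNormedType.Exports.

Local Open Scope classical_set_scope.
Local Open Scope ring_scope.

(* Along a variation with <w', gamma'> = 0 the energy, an explicit function of
   <g', g'>, <g', g''> and <g'', g''>, has derivative
   int rho <gamma'', w''> = - int <V, w'> with V = (rho gamma'')', and the affine
   family gamma + t w realizes every admissible w. Hence gamma is elastic iff V is
   orthogonal to all compactly supported w' normal to T = gamma' with mean zero,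
   that is, iff V - c is tangent for a constant vector c. The multiplier c is
   found by testing against w' = psi (V - c)^perp with psi a bump function; the
   linear system for c is solvable because int psi (1 - T T^t) is invertible
   unless gamma is a straight segment. Equality in Hadamard's inequality makes
   [T, N] orthogonal, so T' = - N kappa, N' = T kappa^t and
   V = - rho |kappa|^2 T - N (rho kappa)'. Tangency of V - c then reads
   (rho kappa)' = - N^t c, and differentiating gives the two equations with
   Lambda = rho |kappa|^2 / 2 - <T, c>; conversely these equations say that
   N (rho kappa)' + (Lambda - rho |kappa|^2 / 2) T is constant. *)

(** * Smooth functions *)

(** The constraint on w' is pointwise, so only the part of V normal to T is tested, and a constant
    vector need not have a constant normal part: the usual lemma on mean-zero test functions does
    not apply as it stands. Test fields must also vanish near a and b, so a multiplier can only be
    produced on intervals ]a', b'[ well inside ]a, b[. All these intervals contain one fixed point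
    x0 with T'(x0) <> 0. A constant vector that is tangent to the curve near such a point is zero,
    which yields both the solvability of the system for c and the agreement of the constants of
    different intervals.

    The data are functions on R controlled on [a, b] only, so two-sided derivatives of different
    representatives can be compared only in the interior. Identities are therefore proved on ]a, b[
    and carried to the endpoints by continuity. *)

Lemma is_derive1D (R : realType) (V : normedModType R) (f g : R -> V) (x : R)
    f' g' :
  is_derive x 1 f f' -> is_derive x 1 g g' ->
  is_derive x 1 (fun y => f y + g y) (f' + g').
Proof. by move=> hf hg; exact: (is_deriveD hf hg). Qed.

Lemma is_derive1B (R : realType) (V : normedModType R) (f g : R -> V) (x : R)
    f' g' :
  is_derive x 1 f f' -> is_derive x 1 g g' ->
  is_derive x 1 (fun y => f y - g y) (f' - g').
Proof. by move=> hf hg; exact: (is_deriveB hf hg). Qed.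

Lemma is_derive1M (R : realType) (f g : R -> R) (x : R) f' g' :
  is_derive x 1 f f' -> is_derive x 1 g g' ->
  is_derive x 1 (fun y => f y * g y) (f' * g x + f x * g').
Proof.
move=> hf hg; rewrite (_ : _ + _ = f x *: g' + g x *: f').
  exact: (is_deriveM hf hg).
by rewrite addrC /GRing.scale /= (mulrC _ f').
Qed.

Lemma is_derive1_sum (R : realType) (V : normedModType R) n
    (f : 'I_n -> R -> V) (x : R) (f' : 'I_n -> V) :
  (forall i, is_derive x 1 (f i) (f' i)) ->
  is_derive x 1 (fun y => \sum_i f i y) (\sum_i f' i).
Proof.
move=> hf; have := is_derive_sum hf.
by rewrite (_ : \sum_i f i = fun y => \sum_i f i y) //;
   apply/funext => y; rewrite fct_sumE.
Qed.

Lemma is_derive1P (R : realType) (V : normedModType R) (f : R -> V) (x : R) f' :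
  is_derive x 1 f f' <-> derivable f x 1 /\ derive1 f x = f'.
Proof. by rewrite derive1E; split=> [[]|[]]. Qed.

Lemma derive1_val (R : realType) (V : normedModType R) (f : R -> V) (x : R) f' :
  is_derive x 1 f f' -> derive1 f x = f'.
Proof. by case/is_derive1P. Qed.

Lemma derivable1P (R : realType) (V : normedModType R) (f : R -> V) (x : R) :
  derivable f x 1 -> is_derive x 1 f (derive1 f x).
Proof. by move=> h; apply/is_derive1P. Qed.

Lemma is_derive_mxP (R : realType) m n (M : R -> 'M[R]_(m, n)) (x : R) D :
  is_derive x 1 M D <-> forall i j, is_derive x 1 (fun y => M y i j) (D i j).
Proof.
split=> [[dM MD] i j|h].
  split; first by move/derivable_mxP : dM; apply.
  by rewrite -MD derive_mx // mxE.
have dM : derivable M x 1 by apply/derivable_mxP => i j; case: (h i j).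
split=> //; rewrite derive_mx //; apply/matrixP => i j; rewrite mxE.
by case: (h i j).
Qed.

Lemma is_derive_dotv (R : realType) n (f g : R -> 'cV[R]_n) (x : R) f' g' :
  is_derive x 1 f f' -> is_derive x 1 g g' ->
  is_derive x 1 (fun y => dotv (f y) (g y)) (dotv f' (g x) + dotv (f x) g').
Proof.
move=> /is_derive_mxP hf /is_derive_mxP hg; rewrite /dotv -big_split /=.
by apply: is_derive1_sum => i; exact: is_derive1M.
Qed.

Lemma is_derive_mulmx (R : realType) m n p (f : R -> 'M[R]_(m, n))
    (g : R -> 'M[R]_(n, p)) (x : R) f' g' :
  is_derive x 1 f f' -> is_derive x 1 g g' ->
  is_derive x 1 (fun y => f y *m g y) (f' *m g x + f x *m g').
Proof.
move=> /is_derive_mxP hf /is_derive_mxP hg; apply/is_derive_mxP => i j.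
rewrite !mxE -big_split /=.
rewrite (_ : (fun y => _) = fun y => \sum_k f y i k * g y k j); last first.
  by apply/funext => y; rewrite mxE.
by apply: is_derive1_sum => k; exact: is_derive1M.
Qed.

Lemma is_derive_scalemx (R : realType) m n (r : R -> R) (f : R -> 'M[R]_(m, n))
    (x : R) r' f' :
  is_derive x 1 r r' -> is_derive x 1 f f' ->
  is_derive x 1 (fun y => r y *: f y) (r' *: f x + r x *: f').
Proof.
move=> hr /is_derive_mxP hf; apply/is_derive_mxP => i j; rewrite !mxE.
rewrite (_ : (fun y => _) = fun y => r y * f y i j); last first.
  by apply/funext => y; rewrite mxE.
exact: is_derive1M.
Qed.

Lemma is_derive_trmx (R : realType) m n (f : R -> 'M[R]_(m, n)) (x : R) f' :
  is_derive x 1 f f' -> is_derive x 1 (fun y => (f y)^T) f'^T.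
Proof.
move=> /is_derive_mxP hf; apply/is_derive_mxP => i j; rewrite !mxE.
rewrite (_ : (fun y => _) = fun y => f y j i) //.
by apply/funext => y; rewrite mxE.
Qed.

Lemma derive1_near (R : realType) (V : normedModType R) (f g : R -> V) (x : R) :
  (\near x, f x = g x) -> derive1 f x = derive1 g x.
Proof. by move=> fg; rewrite !derive1E; exact: near_eq_derive. Qed.

Lemma near_open (R : realType) (U : set R) x : open U -> U x -> \near x, U x.
Proof. by move=> oU Ux; exact: open_nbhs_nbhs. Qed.

Lemma is_derive_continuous (R : realType) (V : normedModType R) (f : R -> V)
    (x : R) f' :
  is_derive x 1 f f' -> {for x, continuous f}.
Proof.
by move=> [df _]; apply: differentiable_continuous; exact/derivable1_diffP.
Qed.

(* An inductive wrapper rather than a definition, so that unification and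
   implicit arguments do not see through it. *)
Variant smooth (R : realType) (V : normedModType R) (U : set R)
    (f : R -> V) : Prop :=
  Smooth of forall (k : nat) (x : R), U x -> derivable (derive1n k f) x 1.

Lemma smoothP (R : realType) (V : normedModType R) (U : set R) (f : R -> V) :
  smooth U f <->
  (forall x, U x -> derivable f x 1) /\ smooth U (derive1 f).
Proof.
split=> [[h]|[h0 [h1]]]; last split=> -[|k] x Ux.
- split=> [x|]; first exact: (h 0%N).
  by split=> k x Ux; rewrite -derive1Sn; exact: h.
- exact: h0.
- by rewrite derive1Sn; exact: h1.
Qed.

Lemma smooth_derive1 (R : realType) (V : normedModType R) U (f : R -> V) :
  smooth U f -> smooth U (derive1 f).
Proof. by case/smoothP. Qed.

Lemma smooth_is_derive (R : realType) (V : normedModType R) U (f : R -> V)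
    (x : R) :
  smooth U f -> U x -> is_derive x 1 f (derive1 f x).
Proof. by case/smoothP => h _ /h; exact: derivable1P. Qed.

Lemma smooth_continuous (R : realType) (V : normedModType R) U (f : R -> V)
    (x : R) :
  smooth U f -> U x -> {for x, continuous f}.
Proof. by move=> sf Ux; exact: is_derive_continuous (smooth_is_derive sf Ux). Qed.

Lemma smooth_sub (R : realType) (V : normedModType R) U W (f : R -> V) :
  W `<=` U -> smooth U f -> smooth W f.
Proof. by move=> WU [sf]; split=> k x /WU; exact: sf. Qed.

Lemma derive1n_eq (R : realType) (V : normedModType R) U (f g : R -> V) k :
  open U -> (forall x, U x -> f x = g x) ->
  forall x, U x -> derive1n k f x = derive1n k g x.
Proof.
move=> oU fg; elim: k => [//|k ih] x Ux; rewrite !derive1nS.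
by apply: derive1_near; near=> y; apply: ih; near: y; exact: near_open.
Unshelve. all: by end_near. Qed.

Lemma smooth_eq (R : realType) (V : normedModType R) U (f g : R -> V) :
  open U -> (forall x, U x -> f x = g x) -> smooth U f -> smooth U g.
Proof.
move=> oU fg [sf]; split=> k x Ux; apply: near_eq_derivable (sf k x Ux).
near=> y; apply: (derive1n_eq _ oU fg); near: y; exact: near_open.
Unshelve. all: by end_near. Qed.

(* Finite orders of differentiability make closure under the ring operations
   provable by induction. *)
Fixpoint diffn (R : realType) (V : normedModType R) n (U : set R)
    (f : R -> V) : Prop :=
  if n is n'.+1 then
    (forall x, U x -> derivable f x 1) /\ diffn n' U (derive1 f)
  else True.

Lemma smooth_diffnP (R : realType) (V : normedModType R) U (f : R -> V) :
  smooth U f <-> forall n, diffn n U f.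
Proof.
split=> [sf n|h]; last split=> k.
  elim: n f sf => [//|n ih] f /smoothP[f0 f1]; split=> //; exact: ih.
elim: k f h => [|k ih] f h x Ux; first by case: (h 1%N) => + _; exact.
rewrite derive1Sn; apply: (ih (derive1 f)) => // n.
by have [] := h n.+1.
Qed.

Lemma diffn_eq (R : realType) (V : normedModType R) U n (f g : R -> V) :
  open U -> (forall x, U x -> f x = g x) -> diffn n U f -> diffn n U g.
Proof.
move=> oU; elim: n f g => [//|n ih] f g fg [df dnf]; split=> [x Ux|].
  apply: near_eq_derivable (df x Ux).
  by near=> y; apply: fg; near: y; exact: near_open.
by apply: ih dnf => x Ux; exact: (@derive1n_eq _ _ _ _ _ 1 oU fg).
Unshelve. all: by end_near. Qed.

Lemma diffnS (R : realType) (V : normedModType R) U n (f : R -> V) :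
  diffn n.+1 U f -> diffn n U f.
Proof. by elim: n f => [//|n ih] f [df /ih]. Qed.

Lemma diffnD (R : realType) (V : normedModType R) U n (f g : R -> V) :
  open U -> diffn n U f -> diffn n U g -> diffn n U (fun x => f x + g x).
Proof.
move=> oU; elim: n f g => [//|n ih] f g [df dnf] [dg dng].
have D x : U x ->
    is_derive x 1 (fun x => f x + g x) (derive1 f x + derive1 g x).
  by move=> Ux; apply: is_derive1D; apply: derivable1P; [exact: df|exact: dg].
split=> [x /D []//|].
by apply: diffn_eq (ih _ _ dnf dng) => // x /D /derive1_val ->.
Qed.

Lemma diffnM (R : realType) U n (f g : R -> R) :
  open U -> diffn n U f -> diffn n U g -> diffn n U (fun x => f x * g x).
Proof.
move=> oU; elim: n f g => [//|n ih] f g hf hg.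
have [df dnf] := hf; have [dg dng] := hg.
have D x : U x ->
    is_derive x 1 (fun x => f x * g x) (derive1 f x * g x + f x * derive1 g x).
  by move=> Ux; apply: is_derive1M; apply: derivable1P; [exact: df|exact: dg].
split=> [x /D []//|].
apply: (@diffn_eq _ _ _ _ (fun x => derive1 f x * g x + f x * derive1 g x)) => //.
  by move=> x /D /derive1_val ->.
by apply: diffnD => //; apply: ih => //; exact: diffnS.
Qed.

Lemma smoothD (R : realType) (V : normedModType R) U (f g : R -> V) :
  open U -> smooth U f -> smooth U g -> smooth U (fun x => f x + g x).
Proof.
by move=> oU /smooth_diffnP hf /smooth_diffnP hg; apply/smooth_diffnP => n;
  exact: diffnD.
Qed.

Lemma smoothM (R : realType) U (f g : R -> R) :
  open U -> smooth U f -> smooth U g -> smooth U (fun x => f x * g x).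
Proof.
by move=> oU /smooth_diffnP hf /smooth_diffnP hg; apply/smooth_diffnP => n;
  exact: diffnM.
Qed.

Lemma smooth_cst (R : realType) (V : normedModType R) U (c : V) :
  smooth U (fun _ : R => c).
Proof.
have D n : diffn n U (fun _ : R => c).
  elim: n c => [//|n ih] c; split=> [x _|]; first exact: derivable_cst.
  rewrite (_ : derive1 _ = fun=> 0); first exact: ih.
  by apply/funext => x; exact: derive1_cst.
exact/smooth_diffnP.
Qed.

Lemma smooth_sum (R : realType) (V : normedModType R) U (I : Type) (s : seq I)
    (f : I -> R -> V) :
  open U -> (forall i, smooth U (f i)) -> smooth U (fun x => \sum_(i <- s) f i x).
Proof.
move=> oU sf; elim: s => [|i s ih].
  rewrite (_ : (fun _ => _) = fun=> 0); first exact: smooth_cst.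
  by apply/funext => x; rewrite big_nil.
rewrite (_ : (fun _ => _) = fun x => f i x + \sum_(i <- s) f i x).
  exact: smoothD.
by apply/funext => x; rewrite big_cons.
Qed.

Lemma smooth_mxP (R : realType) m n U (M : R -> 'M[R]_(m, n)) :
  open U ->
  smooth U M <-> forall i j, smooth U (fun x => M x i j).
Proof.
move=> oU; split=> [sM i j|sM].
  apply/smooth_diffnP => k; move/smooth_diffnP : sM => /(_ k).
  elim: k M => [//|k ih] M [dM dnM]; split=> [x /dM /derivable_mxP //|].
  apply: diffn_eq (ih _ dnM) => // x /dM /derivable1P /is_derive_mxP h.
  by rewrite (derive1_val (h i j)).
apply/smooth_diffnP => k; have {}sM i j : diffn k U (fun x => M x i j).
  by have /smooth_diffnP := sM i j; exact.
elim: k M sM => [//|k ih] M sM.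
have dM x : U x -> derivable M x 1.
  by move=> Ux; apply/derivable_mxP => i j; have [+ _] := sM i j; exact.
split=> //; apply: ih => i j; have [_] := sM i j; apply: diffn_eq => // x /dM.
by move=> /derivable1P /is_derive_mxP h; rewrite (derive1_val (h i j)).
Qed.

Lemma smooth_coord (R : realType) m n U (M : R -> 'M[R]_(m, n)) i j :
  open U -> smooth U M -> smooth U (fun x => M x i j).
Proof. by move=> oU /(smooth_mxP _ oU). Qed.

Lemma smooth_dotv (R : realType) n U (f g : R -> 'cV[R]_n) :
  open U -> smooth U f -> smooth U g -> smooth U (fun x => dotv (f x) (g x)).
Proof.
move=> oU sf sg; apply: smooth_sum => // i.
by apply: smoothM => //; exact: smooth_coord.
Qed.

Lemma smooth_scalemx (R : realType) m n U (r : R -> R) (f : R -> 'M[R]_(m, n)) :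
  open U -> smooth U r -> smooth U f -> smooth U (fun x => r x *: f x).
Proof.
move=> oU sr sf; apply/(smooth_mxP _ oU) => i j.
rewrite (_ : (fun _ => _) = fun x => r x * f x i j); last first.
  by apply/funext => x; rewrite mxE.
exact: smoothM oU sr (smooth_coord i j oU sf).
Qed.

Lemma smoothN (R : realType) m n U (f : R -> 'M[R]_(m, n)) :
  open U -> smooth U f -> smooth U (fun x => - f x).
Proof.
move=> oU sf; rewrite (_ : (fun _ => _) = fun x => (-1) *: f x); last first.
  by apply/funext => x; rewrite scaleN1r.
by apply: smooth_scalemx => //; exact: smooth_cst.
Qed.

Lemma smoothB (R : realType) m n U (f g : R -> 'M[R]_(m, n)) :
  open U -> smooth U f -> smooth U g -> smooth U (fun x => f x - g x).
Proof. by move=> oU sf sg; apply: smoothD => //; exact: smoothN. Qed.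

(** * Bump functions *)

Lemma smooth_affine (R : realType) (f : R -> R) (s c : R) :
  smooth setT f -> smooth setT (fun x => f (s * x + c)).
Proof.
move=> sf; apply/smooth_diffnP => n; elim: n f sf => [//|n ih] f sf.
have D (x : R) : is_derive x 1 (fun x => f (s * x + c)) (derive1 f (s * x + c) * s).
  apply: (@is_derive1_comp R f (fun x => s * x + c)).
    exact: (smooth_is_derive sf).
  rewrite -[X in is_derive _ _ _ X]addr0; apply: is_derive1D.
  rewrite -[X in is_derive _ _ _ X]mulr1 -[s * 1]add0r -(mul0r x).
  exact: (@is_derive1M R (fun=> s) id).
split=> [x _|]; first by case: (D x).
apply: (@diffn_eq _ _ _ _ (fun x => derive1 f (s * x + c) * s)) => //.
- exact: openT.
- by move=> x _; rewrite (derive1_val (D x)).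
apply: diffnM; first exact: openT.
- by apply: ih; exact: smooth_derive1.
- by have /smooth_diffnP := @smooth_cst R _ setT s; exact.
Qed.

Lemma is_derive0_quadratic (R : realType) (f : R -> R) (C : R) :
  (forall h, `|f h| <= C * h ^+ 2) -> is_derive (0 : R) 1 f 0.
Proof.
move=> fC; have f0 : f 0 = 0.
  by apply/eqP; rewrite -normr_le0 (le_trans (fC 0)) // expr0n mulr0.
have C0 : 0 <= C by have := fC 1; rewrite expr1n mulr1; exact: le_trans.
have L : h^-1 *: ((f \o shift 0) (h *: (1 : R)) - f 0) @[h --> 0^'] --> (0 : R).
  apply/cvgrPdist_lt => /= e e0; near=> h.
  rewrite f0 /= sub0r normrN subr0 addr0 /GRing.scale /= mulr1 normrM normfV.
  have h0 : h != 0 by near: h; exact: nbhs_dnbhs_neq.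
  rewrite ltr_pdivrMl ?normr_gt0 //.
  apply: le_lt_trans (fC h) _; rewrite -real_normK ?num_real //.
  have t0 : 0 < `|h| by rewrite normr_gt0.
  have : `|h| < e / (C + 1).
    by near: h; apply: dnbhs0_lt; rewrite divr_gt0 // ltr_wpDl.
  rewrite ltr_pdivlMr ?ltr_wpDl // -(ltr_pM2l t0); apply: le_lt_trans.
  have E (t : R) : t * (t * (C + 1)) = C * t ^+ 2 + t * t by ring.
  by rewrite E lerDl mulr_ge0.
by split; [apply/cvg_ex; exists 0|exact: cvg_lim].
Unshelve. all: by end_near. Qed.

(** The polynomial is a parameter because the functions p(1/x) exp(-1/x), extended by 0, form a
    family stable under differentiation: p becomes X^2 (p - p'). Smoothness is then an induction
    over all p at once. *)
Definition expbump (R : realType) (p : {poly R}) (x : R) : R :=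
  if 0 < x then p.[x^-1] * expR (- x^-1) else 0.

(** With y = 1/h, the bound y^(i+1) / (i+1)! <= exp y from the exponential series gives y^i exp(-y)
    <= (i+1)! h. The constant sums these bounds against the coefficients of p. *)
Lemma expbump_bound (R : realType) (p : {poly R}) :
  exists C, forall h, `|expbump p h| <= C * `|h|.
Proof.
exists (\sum_(i < size p) `|p`_i| * (i.+1)`!%:R) => h; rewrite /expbump.
have [h0|_] := ltP 0 h; last first.
  by rewrite normr0 mulr_ge0 // sumr_ge0 // => i _; rewrite mulr_ge0 ?ler0n.
rewrite horner_coef !mulr_suml (le_trans (ler_norm_sum _ _ _)) // ler_sum // => i _.
rewrite 2!normrM -!mulrA ler_wpM2l // (gtr0_norm h0).
have y0 : 0 < h^-1 by rewrite invr_gt0.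
rewrite !ger0_norm ?expR_ge0 ?exprn_ge0 ?(ltW y0) // expRN ler_pdivrMr ?expR_gt0 //.
rewrite -mulrA mulrCA -(@ler_pM2l _ h^-1) // -exprS mulKf ?gt_eqF //.
have := expR_ge1Dxn i (ltW y0) => /(le_trans _); move/(_ (h^-1 ^+ i.+1 / (i.+1)`!%:R)).
rewrite lerDr ler01 => /(_ isT); rewrite ler_pdivrMr ?ltr0n ?fact_gt0 //.
by rewrite mulrC.
Qed.

Lemma is_derive_expbump (R : realType) (p : {poly R}) (x : R) :
  is_derive x 1 (expbump p) (expbump ('X ^+ 2 * (p - p^`())) x).
Proof.
have [x0|x0|x0] := ltgtP 0 x; last first.
- rewrite -x0 {2}/expbump ltxx; have [C hC] := expbump_bound ('X * p).
  apply: (@is_derive0_quadratic _ _ C) => h.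
  (* Since p(1/h) = h (X p)(1/h), the linear bound for X p is a quadratic bound for p. *)
  suff -> : expbump p h = h * expbump ('X * p) h.
    rewrite normrM -real_normK ?num_real // expr2 mulrA mulrC.
    by rewrite ler_wpM2r.
  rewrite /expbump; case: ifP => h0; last by rewrite mulr0.
  by rewrite hornerM hornerX mulrA mulVKf ?gt_eqF.
- rewrite {2}/expbump ltNge ltW //=.
  apply: near_eq_is_derive (is_derive_cst _ _ _) => /=; near=> y.
  rewrite /expbump ltNge ifF //=; apply/negbF/ltW.
  by near: y; exact: lt_nbhsl.
- rewrite {2}/expbump x0.
  have xn0 : x != 0 by rewrite gt_eqF.
  have dV : is_derive x 1 (fun y : R => y^-1) (- x ^- 2).
    have := @is_deriveV R id x 1 1 xn0 (is_derive_id _ _).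
    by rewrite /GRing.scale /= mulr1.
  have dp : is_derive x 1 (fun y => p.[y^-1]) (p^`().[x^-1] * - x ^- 2).
    exact: (@is_derive1_comp R (horner p) (fun y => y^-1)).
  have dE : is_derive x 1 (fun y => expR (- y^-1)) (expR (- x^-1) * x ^- 2).
    apply: (@is_derive1_comp R expR (fun y => - y^-1)).
    by rewrite -[x ^- 2]opprK; exact: is_deriveN.
  apply: (@near_eq_is_derive R R R (fun y => p.[y^-1] * expR (- y^-1))).
    near=> y; rewrite /expbump ifT //; near: y; exact: lt_nbhsr.
  apply: is_derive_eq (is_derive1M dp dE) _.
  rewrite hornerM hornerXn hornerD hornerN exprVn; ring.
Unshelve. all: by end_near. Qed.

Lemma smooth_expbump (R : realType) (p : {poly R}) : smooth setT (expbump p).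
Proof.
apply/smooth_diffnP => n; elim: n p => [//|n ih] p.
split=> [x _|]; first by case: (is_derive_expbump p x).
rewrite (_ : derive1 _ = expbump ('X ^+ 2 * (p - p^`()))) //.
by apply/funext => x; rewrite (derive1_val (is_derive_expbump p x)).
Qed.

(** The product of a one-sided bump starting at a and a reflected one ending at b. Positivity on the
    whole of ]a, b[ later lets a vanishing weighted integral force its integrand to vanish at every
    point. *)
Lemma smooth_bump (R : realType) (a b : R) :
  exists2 psi : R -> R, smooth setT psi &
    forall x, 0 <= psi x /\ (0 < psi x) = (a < x < b).
Proof.
exists (fun x => expbump 1 (1 * x + - a) * expbump 1 (- 1 * x + b)).
  apply: smoothM; first exact: openT.
    by apply: smooth_affine; exact: smooth_expbump.
  by apply: smooth_affine; exact: smooth_expbump.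
move=> x; rewrite /expbump !hornerE mulN1r subr_gt0 [- x + b]addrC subr_gt0.
case: ifP => ax; case: ifP => xb; rewrite ?mulr0 ?mul0r ?ltxx //=.
by rewrite mulr_gt0 ?mulr_ge0 ?expR_ge0 ?expR_gt0.
Qed.

(** * Integrals of continuous functions *)

Lemma within_continuous_cc (R : realType) (a b : R) (f : R -> R) :
  (forall x, x \in `[a, b] -> {for x, continuous f}) ->
  {within `[a, b], continuous f}.
Proof. by move=> cf; apply: continuous_in_subspaceT => x /set_mem /= /cf. Qed.

Lemma integrable_cc (R : realType) (a b : R) (f : R -> R) :
  (forall x, x \in `[a, b] -> {for x, continuous f}) ->
  (@lebesgue_measure R).-integrable `[a, b] (EFin \o f).
Proof.
move=> cf; apply: continuous_compact_integrable; first exact: segment_compact.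
exact: within_continuous_cc.
Qed.

Lemma eq_derive_cc (R : realType) (a b : R) (F : R -> R) :
  a <= b -> (forall x, x \in `[a, b] -> is_derive x 1 F 0) -> F a = F b.
Proof.
move=> ab dF.
have dF' x : x \in `]a, b[ -> is_derive x 1 F ((fun=> 0) x).
  by move=> /subset_itv_oo_cc; exact: dF.
have cF : {within `[a, b], continuous F}.
  by apply: within_continuous_cc => x /dF; exact: is_derive_continuous.
have [_ _ /eqP] := MVT_segment ab dF' cF.
by rewrite mul0r subr_eq0 => /eqP.
Qed.

Lemma Rintegral_FTC2 (R : realType) (a b : R) (F f : R -> R) :
  a < b -> (forall x, x \in `[a, b] -> is_derive x 1 F (f x)) ->
  (forall x, x \in `[a, b] -> {for x, continuous f}) ->
  \int[@lebesgue_measure R]_(x in `[a, b]) f x = F b - F a.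
Proof.
move=> ab dF cf; rewrite /Rintegral (@continuous_FTC2 _ f F) //.
- exact: within_continuous_cc.
- split=> [x /subset_itv_oo_cc /dF[]//||].
    apply: cvg_at_right_filter; apply: is_derive_continuous (dF a _).
    by rewrite in_itv /= lexx ltW.
  apply: cvg_at_left_filter; apply: is_derive_continuous (dF b _).
  by rewrite in_itv /= lexx ltW.
- by move=> x /subset_itv_oo_cc /dF; exact: derive1_val.
Qed.

(** The integral from a to x is nonnegative and at most the total, hence zero on ]a, b[, and its
    derivative there is f. *)
Lemma Rintegral_eq0_cc (R : realType) (a b : R) (f : R -> R) :
  (forall x, x \in `[a, b] -> {for x, continuous f}) ->
  (forall x, x \in `[a, b] -> 0 <= f x) ->
  \int[@lebesgue_measure R]_(x in `[a, b]) f x = 0 ->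
  forall x, x \in `]a, b[ -> f x = 0.
Proof.
move=> cf f0 If.
pose F x := \int[@lebesgue_measure R]_(t in `[a, x]) f t.
have F0 x : x \in `]a, b[ -> F x = 0.
  rewrite in_itv /= => /andP[ax xb]; apply/eqP; rewrite eq_le.
  have sub : `[a, x] `<=` `[a, b] by apply: subset_itvl; rewrite bnd_simp ltW.
  have -> : 0 <= F x by apply: Rintegral_ge0 => t ht; exact: f0 (sub t ht).
  rewrite andbT.
  have := @Rintegral_itvB R f (BLeft a) (BRight b) x (integrable_cc cf).
  rewrite bnd_simp bnd_simp If sub0r => /(_ (ltW ax) (ltW xb)) E.
  rewrite -oppr_ge0 E; apply: Rintegral_ge0 => t /= ht; apply: f0.
  by move: ht; rewrite !in_itv /= => /andP[xt ->]; rewrite ltW // (lt_trans ax).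
move=> x xab; have := xab; rewrite in_itv /= => /andP[ax xb].
have [] := @continuous_FTC1_closed R f a x b xb (integrable_cc cf) ax.
  by apply: cf; exact: subset_itv_oo_cc.
move=> _ <-; rewrite -[RHS](derive1_cst (0 : R) x); apply: derive1_near.
near=> y; apply: F0; near: y; exact: near_in_itvoo.
Unshelve. all: by end_near. Qed.

(** One-sided limits carry to a and b the identities between derivatives that are accessible only in
    the interior. *)
Lemma continuous_eq_cc (R : realType) (V : normedModType R) (a b : R)
    (f g : R -> V) :
  a < b -> {for a, continuous f} -> {for b, continuous f} ->
  {for a, continuous g} -> {for b, continuous g} ->
  (forall x, x \in `]a, b[ -> f x = g x) ->
  forall x, x \in `[a, b] -> f x = g x.
Proof.
move=> ab fa fb ga gb fg x; rewrite in_itv /= => /andP[].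
rewrite le_eqVlt => /predU1P[<- _|ax].
  have La : f y @[y --> a^'+] --> g a.
    apply: cvg_trans (cvg_at_right_filter ga); apply: near_eq_cvg; near=> y.
    by apply/esym/fg; rewrite in_itv /=; apply/andP; split; near: y;
      [exact: nbhs_right_gt|exact: nbhs_right_lt].
  exact: cvg_unique (cvg_at_right_filter fa) La.
rewrite le_eqVlt => /predU1P[->|xb]; last by apply: fg; rewrite in_itv /= ax.
have Lb : f y @[y --> b^'-] --> g b.
  apply: cvg_trans (cvg_at_left_filter gb); apply: near_eq_cvg; near=> y.
  by apply/esym/fg; rewrite in_itv /=; apply/andP; split; near: y;
    [exact: nbhs_left_gt|exact: nbhs_left_lt].
exact: cvg_unique (cvg_at_left_filter fb) Lb.
Unshelve. all: by end_near. Qed.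

(** [W x] is the integral over [a, x], an empty interval when x < a, so one formula serves on the
    whole line. When the total integral is zero, the primitive has compact support. *)
Lemma smooth_primitive (R : realType) (a b a' b' : R) (y : R -> R) :
  a < a' -> a' < b' -> b' < b -> smooth setT y ->
  (forall x, x <= a' -> y x = 0) -> (forall x, b' <= x -> y x = 0) ->
  exists W : R -> R, [/\ smooth setT W, derive1 W = y,
    forall x, x <= a' -> W x = 0 &
    forall x, b' <= x -> W x = \int[@lebesgue_measure R]_(t in `[a, b]) y t].
Proof.
move=> aa' a'b' b'b sy ya yb.
pose W x := \int[@lebesgue_measure R]_(t in `[a, x]) y t.
have W0 x : x <= a' -> W x = 0.
  move=> xa'; rewrite /W (@eq_Rintegral _ _ _ _ _ (fun=> 0)).
    by rewrite Rintegral_cst ?mul0r.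
  move=> t /set_mem /=; rewrite in_itv /= => /andP[_ tx].
  by rewrite ya // (le_trans tx).
have cy x : {for x, continuous y} by exact: smooth_continuous sy _.
have dW (x : R) : is_derive x 1 W (y x).
  have [xa'|a'x] := ltP x a'.
    rewrite ya ?ltW //; apply: (@near_eq_is_derive R R R (fun=> 0)) => //.
    by near=> z; rewrite W0 // ltW //; near: z; exact: lt_nbhsl.
  apply/is_derive1P; apply: (@continuous_FTC1_closed R y a x (x + 1)).
  - by rewrite ltrDl.
  - by apply: integrable_cc => z _; exact: cy.
  - exact: lt_le_trans a'x.
  - exact: cy.
exists W; split=> //.
- apply/smoothP; split=> [x _|]; first by case: (dW x).
  rewrite (_ : derive1 W = y) //.
  by apply/funext => x; exact: derive1_val.
- by apply/funext => x; exact: derive1_val.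
move=> x b'x; have E z : b' <= z -> W b' = W z.
  move=> b'z; apply: eq_derive_cc => // t; rewrite in_itv /= => /andP[b't _].
  by rewrite -(yb _ b't).
by rewrite -(E x) // (E b) // ltW.
Unshelve. all: by end_near. Qed.

(** * Mixed partial derivatives and differentiation under the integral *)

(** The mean value theorem is applied in x to the increment in t, then in t to the x-derivative at
    the point so found. *)
Lemma second_difference_mvt (R : realType) (f fx fxt : R -> R -> R)
    (t0 x0 r : R) : 0 < r ->
  (forall t x, t \in `[t0, t0 + r] -> x \in `[x0, x0 + r] ->
     is_derive x 1 (f t) (fx t x) /\ is_derive t 1 (fx^~ x) (fxt t x)) ->
  exists t x, [/\ t \in `[t0, t0 + r], x \in `[x0, x0 + r] &
    f (t0 + r) (x0 + r) - f (t0 + r) x0 - (f t0 (x0 + r) - f t0 x0)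
      = fxt t x * r * r].
Proof.
move=> r0 h.
have t0in : t0 \in `[t0, t0 + r] by rewrite in_itv /= lexx lerDl ltW.
have t1in : t0 + r \in `[t0, t0 + r] by rewrite in_itv /= lexx lerDl ltW.
pose phi x := f (t0 + r) x - f t0 x.
have dphi x : x \in `[x0, x0 + r] ->
    is_derive x 1 phi (fx (t0 + r) x - fx t0 x).
  move=> xin; apply: is_derive1B.
    by case: (h _ _ t1in xin).
  by case: (h _ _ t0in xin).
have le_r z : z <= z + r by rewrite lerDl ltW.
have cphi : {within `[x0, x0 + r], continuous phi}.
  by apply: within_continuous_cc => x /dphi; exact: is_derive_continuous.
have [x xin E] := MVT_segment (le_r x0)
  (fun x xin => dphi x (subset_itv_oo_cc xin)) cphi.
have dfx t : t \in `[t0, t0 + r] -> is_derive t 1 (fx^~ x) (fxt t x).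
  by move=> tin; case: (h _ _ tin xin).
have cfx : {within `[t0, t0 + r], continuous (fx^~ x)}.
  by apply: within_continuous_cc => t /dfx; exact: is_derive_continuous.
have [t tin E'] := MVT_segment (le_r t0)
  (fun t tin => dfx t (subset_itv_oo_cc tin)) cfx.
exists t, x; split=> //.
move: E; rewrite E' /phi !(addrC t0 r) !(addrC x0 r) !addrK => <-.
ring.
Qed.

(** The second difference over a small square is symmetric in the two variables, so its quotient by
    r^2 is a value of each mixed partial somewhere in the square. Continuity at the corner
    identifies the two. *)
Lemma mixed_partials_eq (R : realType) (U : set (R * R))
    (f fx ft fxt ftx : R -> R -> R) (t0 x0 : R) :
  open U -> U (t0, x0) ->
  (forall t x, U (t, x) ->
     [/\ is_derive x 1 (f t) (fx t x), is_derive t 1 (f^~ x) (ft t x),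
         is_derive t 1 (fx^~ x) (fxt t x) & is_derive x 1 (ft t) (ftx t x)]) ->
  {for (t0, x0), continuous (fun q : R * R => fxt q.1 q.2)} ->
  {for (t0, x0), continuous (fun q : R * R => ftx q.1 q.2)} ->
  fxt t0 x0 = ftx t0 x0.
Proof.
move=> oU Up h c1 c2; apply/eqP; rewrite -subr_eq0 -normr_eq0 eq_le normr_ge0.
rewrite andbT; apply/ler_addgt0Pl => e e0; rewrite addr0.
have [r r0 hr] : exists2 r, 0 < r & forall t x,
    t \in `[t0, t0 + r] -> x \in `[x0, x0 + r] ->
    [/\ U (t, x), `|fxt t0 x0 - fxt t x| < e / 2 &
        `|ftx t0 x0 - ftx t x| < e / 2].
  have e20 : 0 < e / 2 by rewrite divr_gt0.
  have N : \forall q \near (t0, x0), [/\ U q,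
      `|fxt t0 x0 - fxt q.1 q.2| < e / 2 & `|ftx t0 x0 - ftx q.1 q.2| < e / 2].
    near=> q; split; near: q.
    - exact: open_nbhs_nbhs.
    - exact: (cvgrPdist_lt _ _).1 c1 _ e20.
    - exact: (cvgrPdist_lt _ _).1 c2 _ e20.
  have /nbhs_ballP [d /= d0 hd] := N.
  exists (d / 2); first by rewrite divr_gt0.
  move=> t x; rewrite !in_itv /= => /andP[t1 t2] /andP[x1 x2].
  have dd : d / 2 < d by rewrite ltr_pdivrMr // ltr_pMr // ltr1n.
  apply: (hd (t, x)); split; rewrite /= /ball /= distrC ger0_norm ?subr_ge0 //.
    by apply: le_lt_trans dd; rewrite lerBlDl.
  by apply: le_lt_trans dd; rewrite lerBlDl.
have [t [x [tin xin E]]] := @second_difference_mvt R f fx fxt t0 x0 r r0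
  (fun t x tin xin => let: And3 u _ _ := hr t x tin xin in
     let: And4 a _ c _ := h t x u in conj a c).
have [x' [t' [xin' tin' E']]] := @second_difference_mvt R (fun x t => f t x)
  (fun x t => ft t x) (fun x t => ftx t x) x0 t0 r r0
  (fun x t xin tin => let: And3 u _ _ := hr t x tin xin in
     let: And4 _ b _ d := h t x u in conj b d).
have F : fxt t x = ftx t' x'.
  have rr : r * r != 0 by rewrite mulf_neq0 // gt_eqF.
  apply: (mulIf rr); rewrite !mulrA -E -E'.
  ring.
have [_ a1 _] := hr _ _ tin xin; have [_ _ a2] := hr _ _ tin' xin'.
rewrite -(subrKA (fxt t x)) (le_trans (ler_normD _ _)) //.
by rewrite [e]splitr lerD // ltW // F distrC.
Unshelve. all: by end_near. Qed.

(** [D] is continuous on the compact rectangle, hence bounded, and a constant serves as dominating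
    function. *)
Lemma is_derive_Rintegral (R : realType) (a b eps : R) (F D : R -> R -> R) :
  0 < eps ->
  (forall t x, t \in `[- eps, eps] -> x \in `[a, b] ->
     [/\ is_derive t 1 (F^~ x) (D t x), {for x, continuous (F t)} &
         {for (t, x), continuous (fun q : R * R => D q.1 q.2)}]) ->
  is_derive (0 : R) 1 (fun t => \int[@lebesgue_measure R]_(x in `[a, b]) F t x)
    (\int[@lebesgue_measure R]_(x in `[a, b]) D 0 x).
Proof.
move=> eps0 h.
pose K : set (R * R) := `[- eps, eps] `*` `[a, b].
have [M hM] : exists M, forall t x, t \in `[- eps, eps] -> x \in `[a, b] ->
    `|D t x| <= M.
  have cK : compact ((fun q : R * R => D q.1 q.2) @` K).
    apply: continuous_compact; last by apply: compact_setX; exact: segment_compact.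
    by apply: continuous_in_subspaceT => -[t x] /set_mem [/= /h tin /tin[]].
  have [M [_ hM]] := compact_bounded cK.
  exists (M + 1) => t x tin xin; apply: (hM (M + 1)); first by rewrite ltrDl.
  by exists (t, x).
have sub t : t \in `](- eps), eps[ -> t \in `[- eps, eps].
  exact: subset_itv_oo_cc.
have DE t x : t \in `](- eps), eps[ -> x \in `[a, b] -> partial1of2 F t x = D t x.
  by move=> /sub tin xin; have [+ _ _] := h t x tin xin; exact: derive1_val.
have z : (0 : R) \in `](- eps), eps[ by rewrite in_itv /= oppr_lt0 eps0.
have := @cvg_differentiation_under_integral R _ _ (@lebesgue_measure R) F
  `[a, b] (measurable_itv _) 0 (- eps) eps z.
have -> : \int[@lebesgue_measure R]_(x in `[a, b]) partial1of2 F 0 x =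
    \int[@lebesgue_measure R]_(x in `[a, b]) D 0 x.
  by apply: eq_Rintegral => x /set_mem /=; exact: DE.
move=> /(_ _ _ (fun=> `|M|)) C.
have {}C : h^-1 *: (\int[@lebesgue_measure R]_(x in `[a, b]) F (h + 0) x -
    \int[@lebesgue_measure R]_(x in `[a, b]) F 0 x) @[h --> 0^'] -->
    \int[@lebesgue_measure R]_(x in `[a, b]) D 0 x.
  apply: C => //.
  - move=> t /sub tin; apply: integrable_cc => x xin.
    by have [] := h t x tin xin.
  - by move=> t x /sub tin xin; have [[]] := h t x tin xin.
  - by apply: integrable_cc => x _; exact: cvg_cst.
  - move=> t x tin xin; rewrite DE // (le_trans (hM _ _ _ _)) ?ler_norm //.
    exact: sub.
pose I t := \int[@lebesgue_measure R]_(x in `[a, b]) F t x.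
have L : h^-1 *: ((I \o shift 0) (h *: (1 : R)) - I 0) @[h --> 0^'] -->
    \int[@lebesgue_measure R]_(x in `[a, b]) D 0 x.
  by under eq_fun do rewrite /= /GRing.scale /= mulr1; exact: C.
by split; [apply/cvg_ex; eexists; exact: L|exact: cvg_lim].
Qed.

(** * First variation of the bending energy *)

Lemma cont_funM (R : realType) (T : topologicalType) (f g : T -> R) (p : T) :
  {for p, continuous f} -> {for p, continuous g} ->
  {for p, continuous (fun q => f q * g q)}.
Proof. by move=> cf cg; exact: (cvgM cf cg). Qed.

Lemma cont_funD (R : realType) (T : topologicalType) (f g : T -> R) (p : T) :
  {for p, continuous f} -> {for p, continuous g} ->
  {for p, continuous (fun q => f q + g q)}.
Proof. by move=> cf cg; exact: (cvgD cf cg). Qed.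

Lemma cont_funN (R : realType) (T : topologicalType) (f : T -> R) (p : T) :
  {for p, continuous f} -> {for p, continuous (fun q => - f q)}.
Proof. by move=> cf; exact: (cvgN cf). Qed.

Lemma cont_funV (R : realType) (T : topologicalType) (f : T -> R) (p : T) :
  f p != 0 -> {for p, continuous f} -> {for p, continuous (fun q => (f q)^-1)}.
Proof. by move=> f0 cf; exact: (cvgV f0 cf). Qed.

Lemma cont_fun_sqrt (R : realType) (T : topologicalType) (f : T -> R) (p : T) :
  {for p, continuous f} -> {for p, continuous (fun q => Num.sqrt (f q))}.
Proof.
by move=> cf; apply: continuous_comp; [exact: cf|exact: sqrt_continuous].
Qed.

Lemma cont_fun_coord (R : realType) (T : topologicalType) m n
    (f : T -> 'M[R]_(m, n)) i j (p : T) :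
  {for p, continuous f} -> {for p, continuous (fun q => f q i j)}.
Proof.
move=> cf; apply: (@continuous_comp _ _ _ f (fun M : 'M[R]_(m, n) => M i j)).
  exact: cf.
exact: coord_continuous.
Qed.

Lemma cont_fun_sum (R : realType) (T : topologicalType) n (f : 'I_n -> T -> R)
    (p : T) :
  (forall i, {for p, continuous (f i)}) ->
  {for p, continuous (fun q => \sum_i f i q)}.
Proof.
by move=> cf; apply: cvg_big => [|i _]; [exact: add_continuous|exact: cf].
Qed.

Lemma cont_fun_dotv (R : realType) (T : topologicalType) n
    (f g : T -> 'cV[R]_n) (p : T) :
  {for p, continuous f} -> {for p, continuous g} ->
  {for p, continuous (fun q => dotv (f q) (g q))}.
Proof.
move=> cf cg; apply: cont_fun_sum => i; apply: cont_funM; exact: cont_fun_coord.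
Qed.

Lemma cont_slice (R : realType) (V : normedModType R) (F : R -> R -> V)
    (t x : R) :
  {for (t, x), continuous (fun q : R * R => F q.1 q.2)} ->
  {for x, continuous (F t)}.
Proof.
move=> cF.
apply: (@continuous_comp _ _ _ (fun y : R => (t, y))
  (fun q : R * R => F q.1 q.2)) => //.
by apply: (@cvg_pair _ _ _ (nbhs x) (nbhs t) (nbhs x)); [exact: cvg_cst|exact: cvg_id].
Qed.

(** * The Euclidean inner product *)

Lemma dotvC (R : realType) n (u v : 'cV[R]_n) : dotv u v = dotv v u.
Proof. by apply: eq_bigr => i _; rewrite mulrC. Qed.

Lemma dotvDl (R : realType) n (u v w : 'cV[R]_n) :
  dotv (u + v) w = dotv u w + dotv v w.
Proof. by rewrite /dotv -big_split; apply: eq_bigr => i _; rewrite mxE mulrDl. Qed.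

Lemma dotvZl (R : realType) n (r : R) (u v : 'cV[R]_n) :
  dotv (r *: u) v = r * dotv u v.
Proof. by rewrite /dotv mulr_sumr; apply: eq_bigr => i _; rewrite mxE mulrA. Qed.

Lemma dotvNl (R : realType) n (u v : 'cV[R]_n) : dotv (- u) v = - dotv u v.
Proof. by rewrite -scaleN1r dotvZl mulN1r. Qed.

Lemma dotvDr (R : realType) n (u v w : 'cV[R]_n) :
  dotv u (v + w) = dotv u v + dotv u w.
Proof. by rewrite dotvC dotvDl !(dotvC u). Qed.

Lemma dotvZr (R : realType) n (r : R) (u v : 'cV[R]_n) :
  dotv u (r *: v) = r * dotv u v.
Proof. by rewrite dotvC dotvZl dotvC. Qed.

Lemma dotvNr (R : realType) n (u v : 'cV[R]_n) : dotv u (- v) = - dotv u v.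
Proof. by rewrite dotvC dotvNl dotvC. Qed.

Definition dotvE := (dotvDl, dotvDr, dotvNl, dotvNr, dotvZl, dotvZr).

Lemma dotv_ge0 (R : realType) n (u : 'cV[R]_n) : 0 <= dotv u u.
Proof. by apply: sumr_ge0 => i _; rewrite -expr2 sqr_ge0. Qed.

Lemma dotv_eq0 (R : realType) n (u : 'cV[R]_n) : (dotv u u == 0) = (u == 0).
Proof.
apply/idP/eqP => [|->]; last first.
  by rewrite /dotv big1 // => i _; rewrite mxE mul0r.
rewrite psumr_eq0 => [/allP h|i _]; last by rewrite -expr2 sqr_ge0.
apply/matrixP => i j; rewrite ord1 mxE; apply/eqP.
by have := h i (mem_index_enum i); rewrite -expr2 sqrf_eq0.
Qed.

Lemma dotv_gt0 (R : realType) n (u : 'cV[R]_n) : (0 < dotv u u) = (u != 0).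
Proof. by rewrite lt_def dotv_ge0 andbT dotv_eq0. Qed.

Lemma enorm1 (R : realType) n (u : 'cV[R]_n) : enorm u = 1 -> dotv u u = 1.
Proof. by move=> u1; rewrite -(sqr_sqrtr (dotv_ge0 u)) -/(enorm u) u1 expr1n. Qed.

(** * The energy density of a regular curve *)

Lemma is_derive_invfun (R : realType) (f : R -> R) (x f' : R) :
  f x != 0 -> is_derive x 1 f f' ->
  is_derive x 1 (fun y => (f y)^-1) (- ((f x)^-1 * (f x)^-1 * f')).
Proof.
move=> f0 df; have := @is_deriveV R f x f' 1 f0 df.
by rewrite /GRing.scale /= mulNr -invfM -expr2.
Qed.

Lemma is_derive_sqrtfun (R : realType) (f : R -> R) (x f' : R) :
  0 < f x -> is_derive x 1 f f' ->
  is_derive x 1 (fun y => Num.sqrt (f y)) ((2 * Num.sqrt (f x))^-1 * f').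
Proof. by move=> f0 df; exact: (is_derive1_comp (is_derive1_sqrt f0) df). Qed.

(* The integrand of the bending energy, in terms of s = <g', g'>,
   p = <g', g''> and q = <g'', g''>. *)
Definition bending_density (R : realType) (s p q : R) : R :=
  (q * s - p * p) * (s^-1 * s^-1 * s^-1 * Num.sqrt s).

(** From T = g' / sqrt s one gets dT/ds = g'' / s - (p / s^2) g', whose square is (q s - p^2) / s^3;
    the remaining factor sqrt s is ds/dx. *)
Lemma bending_densityE (R : realType) n (g : R -> 'cV[R]_n) (x : R) B :
  derive1 g x != 0 -> is_derive x 1 (derive1 g) B ->
  dotv (dds g (tangent g) x) (dds g (tangent g) x) * enorm (derive1 g x) =
  bending_density (dotv (derive1 g x) (derive1 g x)) (dotv (derive1 g x) B)
    (dotv B B).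
Proof.
rewrite -dotv_gt0 => s0 dB; set A := derive1 g x in s0 *.
set s := dotv A A in s0 *.
have r0 : 0 < Num.sqrt s by rewrite sqrtr_gt0.
have rr : Num.sqrt s ^+ 2 = s by rewrite sqr_sqrtr // ltW.
have dT : derive1 (tangent g) x = (Num.sqrt s)^-1 *: B -
    (dotv A B / (s * Num.sqrt s)) *: A.
  apply: derive1_val; rewrite addrC -scaleNr.
  have dv := is_derive_sqrtfun s0 (is_derive_dotv dB dB).
  have := is_derive_scalemx (is_derive_invfun _ dv) dB.
  move=> /(_ (lt0r_neq0 r0)); rewrite -/A -/s (dotvC B) -[X in s * X]/(Num.sqrt s).
  congr is_derive; congr (_ *: _ + _).
  move: (Num.sqrt s) r0 rr (dotv A B) => r r0; clearbody s => <- p.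
  by field; rewrite gt_eqF.
rewrite {1 2}/dds /enorm -/A -/s dT /bending_density.
rewrite !dotvE (dotvC B A) -/s; set p := dotv A B; set q := dotv B B.
move: (Num.sqrt s) r0 rr => r r0; clearbody s p q => <-.
by field; rewrite gt_eqF.
Qed.

(** The derivative exactly as the product rule delivers it, left unsimplified: it is only evaluated
    at s = 1, p = 0, s' = 0, where it collapses to q'. *)
Definition bending_density' (R : realType) (s p q s' p' q' : R) : R :=
  let i := s^-1 in let i' := - (i * i * s') in let r := Num.sqrt s in
  (q' * s + q * s' - (p' * p + p * p')) * (i * i * i * r) +
  (q * s - p * p) *
    (((i' * i + i * i') * i + i * i * i') * r + i * i * i * ((2 * r)^-1 * s')).

Lemma is_derive_bending_density (R : realType) (s p q : R -> R)
    (t s' p' q' : R) :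
  0 < s t -> is_derive t 1 s s' -> is_derive t 1 p p' -> is_derive t 1 q q' ->
  is_derive t 1 (fun t => bending_density (s t) (p t) (q t))
    (bending_density' (s t) (p t) (q t) s' p' q').
Proof.
move=> s0 ds dp dq.
have di := is_derive_invfun (lt0r_neq0 s0) ds.
have dr := is_derive_sqrtfun s0 ds.
exact: (is_derive1M (is_derive1B (is_derive1M dq ds) (is_derive1M dp dp))
  (is_derive1M (is_derive1M (is_derive1M di di) di) dr)).
Qed.

Lemma cont_bending_density (R : realType) (T : topologicalType)
    (s p q : T -> R) (x : T) :
  0 < s x -> {for x, continuous s} -> {for x, continuous p} ->
  {for x, continuous q} ->
  {for x, continuous (fun y => bending_density (s y) (p y) (q y))}.
Proof.
move=> s0 cs cp cq.
have ci := cont_funV (lt0r_neq0 s0) cs.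
have cr := cont_fun_sqrt cs.
exact: (cont_funM (cont_funD (cont_funM cq cs) (cont_funN (cont_funM cp cp)))
  (cont_funM (cont_funM (cont_funM ci ci) ci) cr)).
Qed.

Lemma cont_cst (R : realType) (T : topologicalType) (c : R) (x : T) :
  {for x, continuous (fun _ : T => c)}.
Proof. exact: cvg_cst. Qed.

Lemma cont_bending_density' (R : realType) (T : topologicalType)
    (s p q s' p' q' : T -> R) (x : T) :
  0 < s x -> {for x, continuous s} -> {for x, continuous p} ->
  {for x, continuous q} -> {for x, continuous s'} -> {for x, continuous p'} ->
  {for x, continuous q'} ->
  {for x, continuous
    (fun y => bending_density' (s y) (p y) (q y) (s' y) (p' y) (q' y))}.
Proof.
move=> s0 cs cp cq cs' cp' cq'.
have ci := cont_funV (lt0r_neq0 s0) cs.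
have cr := cont_fun_sqrt cs.
have ci' := cont_funN (cont_funM (cont_funM ci ci) cs').
have r0 : 2 * Num.sqrt (s x) != 0.
  by rewrite mulf_neq0 // gt_eqF // sqrtr_gt0.
have cv := @cont_funV R T (fun y => 2 * Num.sqrt (s y)) x r0
  (cont_funM (@cont_cst R T 2 x) cr).
apply: cont_funD; apply: cont_funM.
- apply: cont_funD; first by apply: cont_funD; exact: cont_funM.
  by apply: cont_funN; apply: cont_funD; exact: cont_funM.
- by do 3!apply: cont_funM => //.
- by apply: cont_funD; [|apply: cont_funN]; exact: cont_funM.
- apply: cont_funD; apply: cont_funM => //.
  + apply: cont_funD; apply: cont_funM => //; last exact: cont_funM.
    by apply: cont_funD; exact: cont_funM.
  + by do 2!apply: cont_funM => //.
  + exact: cont_funM.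
Qed.

(** * Derivatives of a variation and of its energy *)

Lemma smooth2_is_derive (R : realType) (V : normedModType R)
    (U : set (R * R)) (G : R -> R -> V) :
  (forall (s : seq bool) (p : R * R), U p ->
      let H := iter_partial s G in
      [/\ {for p, continuous (fun q : R * R => H q.1 q.2)},
          derivable (fun t => H t p.2) p.1 1 &
          derivable (H p.1) p.2 1]) ->
  forall s t x, U (t, x) ->
    [/\ {for (t, x), continuous (fun q : R * R => iter_partial s G q.1 q.2)},
      is_derive t 1 (fun u => iter_partial s G u x)
        (iter_partial (true :: s) G t x) &
      is_derive x 1 (iter_partial s G t) (iter_partial (false :: s) G t x)].
Proof.
move=> h s t x Utx; have [c dt dx] := h s (t, x) Utx.
by split=> //; exact: derivable1P.
Qed.

(** Only the last two derivatives trade places, coordinate by coordinate. Applied at successive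
    depths, this brings d/dt next to [G], where it produces the variational field. *)
Lemma iter_partial_swap (R : realType) n (U : set (R * R))
    (G : R -> R -> 'cV[R]_n) (s : seq bool) (t x : R) : open U ->
  (forall s t x, U (t, x) ->
    [/\ {for (t, x), continuous (fun q : R * R => iter_partial s G q.1 q.2)},
      is_derive t 1 (fun u => iter_partial s G u x)
        (iter_partial (true :: s) G t x) &
      is_derive x 1 (iter_partial s G t) (iter_partial (false :: s) G t x)]) ->
  U (t, x) ->
  iter_partial [:: true, false & s] G t x =
  iter_partial [:: false, true & s] G t x.
Proof.
move=> oU h Utx; apply/matrixP => i j.
pose c s t x := iter_partial s G t x i j.
apply: (@mixed_partials_eq R U (c s) (c (false :: s)) (c (true :: s))
  (c [:: true, false & s]) (c [:: false, true & s])) => //.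
- move=> t' x' Utx'; have [_ a1 a2] := h s _ _ Utx'.
  have [_ b1 _] := h (false :: s) _ _ Utx'.
  have [_ _ b2] := h (true :: s) _ _ Utx'.
  by split; apply: (is_derive_mxP _ _ _).1.
- by have [+ _ _] := h [:: true, false & s] _ _ Utx; exact: cont_fun_coord.
- by have [+ _ _] := h [:: false, true & s] _ _ Utx; exact: cont_fun_coord.
Qed.

Lemma near_itv_oo (R : realType) (a b x : R) (P : R -> Prop) :
  x \in `]a, b[ -> (forall y, y \in `]a, b[ -> P y) -> \near x, P x.
Proof. by move=> xab h; near=> y; apply: h; near: y; exact: near_in_itvoo.
Unshelve. all: by end_near. Qed.

Lemma dotv_derive_unit (R : realType) n (T : R -> 'cV[R]_n) (x : R) T' :
  is_derive x 1 T T' -> (\near x, dotv (T x) (T x) = 1) -> dotv T' (T x) = 0.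
Proof.
move=> dT T1; have := derive1_val (is_derive_dotv dT dT).
rewrite (@derive1_near R R _ (fun=> 1)) // derive1_cst (dotvC (T x)).
by move/eqP; rewrite eq_sym -mulr2n mulrn_eq0 => /eqP.
Qed.

(** At t = 0 unit speed gives s = 1 and p = 0, and the constraint gives s' = 2 <w', gamma'> = 0.
    Only q' = 2 <gamma'', w''> survives, and its factor 2 cancels the 1/2 of the energy. The result
    depends on the variation through w alone. *)
Lemma first_variation (R : realType) n (a b : R) (gamma : R -> 'cV[R]_n)
    (rho : R -> R) (w : R -> 'cV[R]_n) (eps : R) (G : R -> R -> 'cV[R]_n) :
  a < b -> arclength_parametrized a b gamma -> stiffness a b rho ->
  smooth setT w ->
  (forall x, x \in `[a, b] -> dotv (derive1 w x) (derive1 gamma x) = 0) ->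
  smooth_variation a b gamma eps G ->
  (forall x, x \in `[a, b] -> variational_field G x = w x) ->
  is_derive (0 : R) 1 (fun t => bending_energy a b rho (G t))
    (\int[@lebesgue_measure R]_(x in `[a, b])
       (rho x * dotv (derive1 (derive1 gamma) x) (derive1 (derive1 w) x))).
Proof.
move=> ab [[[Ug [oUg ABg /Smooth sg]] _] g1] [[Ur [oUr ABr /Smooth sr]] _] sw.
move=> ortho [eps0 [U [oU KU hU]] cG G0] vf.
move/smooth2_is_derive : hU => h.
have inU (t x : R) : t \in `[- eps, eps] -> x \in `[a, b] -> U (t, x).
  by move=> tin xin; exact: KU.
have z : (0 : R) \in `[- eps, eps] by rewrite in_itv /= oppr_le0 ltW.
have ooW x : x \in `]a, b[ -> x \in `[a, b] by exact: subset_itv_oo_cc.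
pose H (l : seq bool) (t x : R) : 'cV[R]_n := iter_partial l G t x.
pose s (t x : R) : R := dotv (H [:: false] t x) (H [:: false] t x).
pose p (t x : R) : R := dotv (H [:: false] t x) (H [:: false; false] t x).
pose q (t x : R) : R := dotv (H [:: false; false] t x) (H [:: false; false] t x).
pose s' (t x : R) : R := dotv (H [:: true; false] t x) (H [:: false] t x) +
  dotv (H [:: false] t x) (H [:: true; false] t x).
pose p' (t x : R) : R := dotv (H [:: true; false] t x) (H [:: false; false] t x) +
  dotv (H [:: false] t x) (H [:: true; false; false] t x).
pose q' (t x : R) : R := dotv (H [:: true; false; false] t x) (H [:: false; false] t x) +
  dotv (H [:: false; false] t x) (H [:: true; false; false] t x).
pose F (t x : R) : R := rho x * bending_density (s t x) (p t x) (q t x).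
pose D (t x : R) : R := rho x *
  bending_density' (s t x) (p t x) (q t x) (s' t x) (p' t x) (q' t x).
have s0 (t x : R) : t \in `[- eps, eps] -> x \in `[a, b] -> 0 < s t x.
  by move=> tin xin; rewrite dotv_gt0; have [_] := cG t tin; exact.
have crho x : x \in `[a, b] -> {for x, continuous rho}.
  by move=> xin; apply: smooth_continuous sr _; exact: ABr.
have crho2 (t x : R) : x \in `[a, b] ->
    {for (t, x), continuous (fun q : R * R => rho q.2)}.
  move=> xin; apply: (@continuous_comp _ _ _ snd rho); last exact: crho.
  exact: cvg_snd.
have cH l (t x : R) : t \in `[- eps, eps] -> x \in `[a, b] ->
    {for (t, x), continuous (fun q : R * R => H l q.1 q.2)}.
  by move=> tin xin; have [] := h l t x (inU _ _ tin xin).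
have cF (t x : R) : t \in `[- eps, eps] -> x \in `[a, b] ->
    {for (t, x), continuous (fun q : R * R => F q.1 q.2)}.
  move=> tin xin; apply: cont_funM; first exact: crho2.
  by apply: cont_bending_density; rewrite /= ?s0 //; apply: cont_fun_dotv; exact: cH.
have cD (t x : R) : t \in `[- eps, eps] -> x \in `[a, b] ->
    {for (t, x), continuous (fun q : R * R => D q.1 q.2)}.
  move=> tin xin; apply: cont_funM; first exact: crho2.
  by apply: cont_bending_density'; rewrite /= ?s0 //; try apply: cont_funD;
    apply: cont_fun_dotv; exact: cH.
have dF (t x : R) : t \in `[- eps, eps] -> x \in `[a, b] ->
    is_derive t 1 (F^~ x) (D t x).
  move=> tin xin; have Utx := inU _ _ tin xin.
  have [_ dA _] := h [:: false] t x Utx.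
  have [_ dB _] := h [:: false; false] t x Utx.
  rewrite /D -[X in is_derive _ _ _ X]add0r -[X in X + _](mul0r
    (bending_density (s t x) (p t x) (q t x))).
  apply: (@is_derive1M R (fun=> rho x)
    (fun t => bending_density (s t x) (p t x) (q t x))).
  exact: (@is_derive_bending_density R (s^~ x) (p^~ x) (q^~ x) t _ _ _
    (s0 _ _ tin xin) (is_derive_dotv dA dA) (is_derive_dotv dA dB)
    (is_derive_dotv dB dB)).
have dI := is_derive_Rintegral eps0 (fun t x tin xin =>
  And3 (dF t x tin xin) (cont_slice (cF t x tin xin)) (cD t x tin xin)).
pose X (x : R) : R := rho x * dotv (derive1 (derive1 gamma) x) (derive1 (derive1 w) x).
have cX x : x \in `[a, b] -> {for x, continuous X}.
  move=> xin; apply: cont_funM; first exact: crho.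
  apply: cont_fun_dotv.
    by apply: smooth_continuous (ABg _ xin); do 2!apply: smooth_derive1.
  by apply: (@smooth_continuous _ _ setT) => //; do 2!apply: smooth_derive1.
have D0 : \int[@lebesgue_measure R]_(x in `[a, b]) D 0 x =
    2 * \int[@lebesgue_measure R]_(x in `[a, b]) X x.
  rewrite -RintegralZl //; last exact: integrable_cc.
  have aab : a \in `[a, b] by rewrite in_itv /= lexx ltW.
  have bab : b \in `[a, b] by rewrite in_itv /= lexx ltW.
  have c2 x : x \in `[a, b] -> {for x, continuous (fun x => 2 * X x)}.
    by move=> xin; apply: cont_funM; [exact: cont_cst|exact: cX].
  (* [G 0] agrees with [gamma] on [a, b] only, so derivatives are compared in the interior and the
     endpoints follow by continuity of both integrands. *)
  apply: eq_Rintegral => x /set_mem /=; move: x; apply: continuous_eq_cc => //.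
  - exact: cont_slice (cD 0 a z aab).
  - exact: cont_slice (cD 0 b z bab).
  - exact: c2.
  - exact: c2.
  move=> x xin; have xab := ooW _ xin.
  have oab : open [set` `]a, b[] by exact: interval_open.
  have GE k : derive1n k (G 0) x = derive1n k gamma x.
    by apply: derive1n_eq oab _ _ xin => y /ooW; exact: G0.
  have GE1 : derive1 (G 0) x = derive1 gamma x := GE 1%N.
  have GE2 : derive1 (derive1 (G 0)) x = derive1 (derive1 gamma) x := GE 2%N.
  (* Symmetry of the mixed partials turns d/dt of the x-derivative of [G] into w'; one more
     x-derivative gives [vE2]. *)
  have vE1 y : y \in `]a, b[ -> H [:: true; false] 0 y = derive1 w y.
    move=> yin; rewrite /H (iter_partial_swap [::] oU h (inU _ _ z (ooW _ yin))).
    by apply: (@derive1n_eq _ _ _ (iter_partial [:: true] G 0) w 1 oab _ y yin) => u /ooW;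
      exact: vf.
  have vE2 : H [:: true; false; false] 0 x = derive1 (derive1 w) x.
    rewrite /H (iter_partial_swap [:: false] oU h (inU _ _ z xab)).
    exact: (@derive1n_eq _ _ _ (iter_partial [:: true; false] G 0) (derive1 w) 1
      oab vE1 x xin).
  have gg : s 0 x = 1.
    by rewrite /s /H /iter_partial GE1 (enorm1 (g1 x xab)).
  have gK : dotv (derive1 gamma x) (derive1 (derive1 gamma) x) = 0.
    have dg := smooth_is_derive (smooth_derive1 sg) (ABg _ xab).
    apply: (etrans (dotvC _ _)); apply: (dotv_derive_unit dg).
    by apply: near_itv_oo xin _ => y /ooW /g1 /enorm1.
  have pp : p 0 x = 0 by rewrite /p /H /iter_partial GE1 GE2.
  have ss : s' 0 x = 0.
    by rewrite /s' (vE1 x xin) /H /iter_partial GE1 (dotvC (derive1 gamma x))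
      (ortho x xab) addr0.
  rewrite /D /bending_density' gg pp ss !(mulr0, mul0r, oppr0, addr0, subr0).
  rewrite invr1 sqrtr1 !mulr1 /q' vE2 /H /iter_partial GE2 /X.
  rewrite [X in X + _]dotvC.
  by move: (rho x) (dotv _ _) => r y; ring.
have -> : \int[@lebesgue_measure R]_(x in `[a, b]) X x =
    0 * \int[@lebesgue_measure R]_(x in `[a, b]) F 0 x +
    2^-1 * \int[@lebesgue_measure R]_(x in `[a, b]) D 0 x.
  by rewrite D0 mul0r add0r mulKf.
apply: near_eq_is_derive (@is_derive1M R (fun=> 2^-1)
  (fun t => \int[@lebesgue_measure R]_(x in `[a, b]) F t x) 0 0 _
  (@is_derive_cst R R R 2^-1 0 1) dI) => /=.
(* The density formula needs a regular curve, which is granted for t in [-eps, eps], a neighbourhood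
   of 0. *)
have z' : (0 : R) \in `](- eps), eps[ by rewrite in_itv /= oppr_lt0 eps0.
apply: near_itv_oo z' _ => t /subset_itv_oo_cc tin; rewrite /bending_energy.
congr (_ * _); apply: eq_Rintegral => x /set_mem /= xin; rewrite /F -mulrA.
have Utx := inU _ _ tin xin; have [_ _ dB] := h [:: false] t x Utx.
by rewrite (bending_densityE _ dB) // -dotv_gt0 s0.
Qed.

(** * Affine variations *)

Lemma smooth_is_derive1n (R : realType) (V : normedModType R) U (f : R -> V) k
    (x : R) :
  smooth U f -> U x -> is_derive x 1 (derive1n k f) (derive1n k.+1 f x).
Proof. by move=> [sf] Ux; apply: derivable1P; exact: sf. Qed.

(* The mixed partial derivatives of g x + t *: w x, taken k times in t and
   j times in x. *)
Definition affine_partial (R : realType) n (g w : R -> 'cV[R]_n) (k j : nat)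
    (t x : R) : 'cV[R]_n :=
  match k with
  | 0 => derive1n j g x + t *: derive1n j w x
  | 1 => derive1n j w x
  | _ => 0
  end.

Lemma is_derive_affine_partial (R : realType) n (U : set R)
    (g w : R -> 'cV[R]_n) k j (t x : R) :
  smooth U g -> smooth setT w -> U x ->
  is_derive t 1 (fun u => affine_partial g w k j u x)
    (affine_partial g w k.+1 j t x) /\
  is_derive x 1 (affine_partial g w k j t) (affine_partial g w k j.+1 t x).
Proof.
move=> sg sw Ux.
have dg := smooth_is_derive1n j sg Ux.
have dw := smooth_is_derive1n j sw I.
case: k => [|[|k]] /=; split.
- have /= := is_derive1D (@is_derive_cst R R _ (derive1n j g x) t 1)
    (is_derive_scalemx (@is_derive_id R R t 1)
       (@is_derive_cst R R _ (derive1n j w x) t 1)).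
  by rewrite scaler0 addr0 add0r scale1r.
- have /= := is_derive1D dg (is_derive_scalemx (@is_derive_cst R R R t x 1) (dw x)).
  by rewrite scale0r add0r.
- exact: is_derive_cst.
- exact: dw.
- exact: is_derive_cst.
- exact: is_derive_cst.
Qed.

Lemma cont_affine_partial (R : realType) n (U : set R)
    (g w : R -> 'cV[R]_n) k j (t x : R) :
  smooth U g -> smooth setT w -> U x ->
  {for (t, x), continuous (fun q : R * R => affine_partial g w k j q.1 q.2)}.
Proof.
move=> sg sw Ux.
have cg : {for (t, x), continuous (fun q : R * R => derive1n j g q.2)}.
  apply: (@continuous_comp _ _ _ snd (derive1n j g)); first exact: cvg_snd.
  exact: is_derive_continuous (smooth_is_derive1n j sg Ux).
have cw : {for (t, x), continuous (fun q : R * R => derive1n j w q.2)}.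
  apply: (@continuous_comp _ _ _ snd (derive1n j w)); first exact: cvg_snd.
  exact: is_derive_continuous (smooth_is_derive1n j sw I).
case: k => [|[|k]]; [|exact: cw|exact: cvg_cst].
by apply: cvgD; [exact: cg|apply: cvgZ; [exact: cvg_fst|exact: cw]].
Qed.

(** At each stage of the induction the identity holds on a neighbourhood, in x because U is open, so
    it can be differentiated once more. The order of the letters is irrelevant here, which makes all
    partial derivatives explicit. *)
Lemma iter_partial_affine (R : realType) n (U : set R) (g w : R -> 'cV[R]_n)
    (s : seq bool) (t x : R) :
  open U -> smooth U g -> smooth setT w -> U x ->
  iter_partial s (fun t x => g x + t *: w x) t x =
  affine_partial g w (count id s) (count negb s) t x.
Proof.
move=> oU sg sw; elim: s t x => [//|c s ih] t x Ux.
have [dt dx] :=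
  is_derive_affine_partial (count id s) (count negb s) t sg sw Ux.
rewrite (_ : count id _ = if c then (count id s).+1 else count id s);
  last by case: c.
rewrite (_ : count negb _ = if c then count negb s else (count negb s).+1);
  last by case: c.
case: c.
  rewrite -(derive1_val dt); apply: derive1_near; near=> u.
  exact: ih.
rewrite -(derive1_val dx); apply: derive1_near; near=> y.
by apply: ih; near: y; exact: near_open.
Unshelve. all: by end_near. Qed.

(** Orthogonality gives |gamma' + t w'|^2 = 1 + t^2 |w'|^2 > 0, so every curve of the family is
    regular and the bound 1 on t is arbitrary. *)
Lemma affine_smooth_variation (R : realType) n (a b : R)
    (gamma w : R -> 'cV[R]_n) :
  arclength_parametrized a b gamma -> smooth setT w ->
  (forall x, x \in `[a, b] -> dotv (derive1 w x) (derive1 gamma x) = 0) ->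
  smooth_variation a b gamma 1 (fun t x => gamma x + t *: w x) /\
  forall x, variational_field (fun t x => gamma x + t *: w x) x = w x.
Proof.
move=> [[[U [oU abU /Smooth sg]] _] g1] sw ortho.
split; last first.
  move=> x; apply: derive1_val.
  have := is_derive1D (@is_derive_cst R R _ (gamma x) 0 1)
    (is_derive_scalemx (@is_derive_id R R 0 1) (@is_derive_cst R R _ (w x) 0 1)).
  by rewrite scaler0 addr0 add0r scale1r.
split=> [//||t tin|x xin]; last by rewrite scale0r addr0.
  exists (snd @^-1` U); split.
  - by apply: open_comp => // x _; exact: cvg_snd.
  - by move=> [t x] [_ /= /abU].
  move=> s [t x] /= Ux.
  have [dt dx] :=
    is_derive_affine_partial (count id s) (count negb s) t sg sw Ux.
  have oU2 : open (@snd R R @^-1` U).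
    by apply: open_comp => // y _; exact: cvg_snd.
  split.
  - have := @cont_affine_partial _ _ U gamma w (count id s) (count negb s) t x
      sg sw Ux.
    rewrite /prop_for /continuous_at /= (iter_partial_affine _ _ oU sg sw Ux).
    apply: cvg_trans; apply: near_eq_cvg; near=> q.
    rewrite -(iter_partial_affine _ _ oU sg sw) //.
    by near: q; apply: (@open_nbhs_nbhs _ (t, x) (snd @^-1` U)).
  - apply: near_eq_derivable (ex_derive (is_derive := dt)) => /=; near=> u.
    by rewrite (iter_partial_affine _ _ oU sg sw).
  - apply: near_eq_derivable (ex_derive (is_derive := dx)) => /=; near=> y.
    rewrite (iter_partial_affine _ _ oU sg sw) //.
    by near: y; exact: near_open.
have sG : smooth U (fun x => gamma x + t *: w x).
  apply: smoothD => //; apply: smooth_scalemx => //; first exact: smooth_cst.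
  exact: (smooth_sub (@subsetT _ U) sw).
split; first by exists U; split=> //; case: sG.
move=> x xin.
have dg := smooth_is_derive sg (abU _ xin).
have dw := @smooth_is_derive R _ _ w x sw I.
have dG : is_derive x 1 (fun x => gamma x + t *: w x)
    (derive1 gamma x + t *: derive1 w x).
  have /= := is_derive1D dg (is_derive_scalemx (@is_derive_cst R R R t x 1) dw).
  by rewrite scale0r add0r.
rewrite (derive1_val dG).
rewrite -dotv_gt0 !dotvE (enorm1 (g1 x xin)) (ortho x xin).
rewrite [dotv _ (derive1 w x)]dotvC (ortho x xin) !mulr0 addr0 add0r.
by rewrite ltr_pwDl // mulrA mulr_ge0 ?dotv_ge0 // -expr2 sqr_ge0.
Unshelve. all: by end_near. Qed.

(** * Elasticity in weak form *)

Lemma RintegralD_cc (R : realType) (a b : R) (f g : R -> R) :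
  (forall x, x \in `[a, b] -> {for x, continuous f}) ->
  (forall x, x \in `[a, b] -> {for x, continuous g}) ->
  \int[@lebesgue_measure R]_(x in `[a, b]) (f x + g x) =
  \int[@lebesgue_measure R]_(x in `[a, b]) f x +
  \int[@lebesgue_measure R]_(x in `[a, b]) g x.
Proof. by move=> cf cg; rewrite RintegralD //; exact: integrable_cc. Qed.

Lemma RintegralZ_cc (R : realType) (a b c : R) (f : R -> R) :
  (forall x, x \in `[a, b] -> {for x, continuous f}) ->
  \int[@lebesgue_measure R]_(x in `[a, b]) (c * f x) =
  c * \int[@lebesgue_measure R]_(x in `[a, b]) f x.
Proof. by move=> cf; rewrite RintegralZl //; exact: integrable_cc. Qed.

Lemma Rintegral_sum_cc (R : realType) (a b : R) n (f : 'I_n -> R -> R) :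
  (forall i x, x \in `[a, b] -> {for x, continuous (f i)}) ->
  \int[@lebesgue_measure R]_(x in `[a, b]) (\sum_i f i x) =
  \sum_i \int[@lebesgue_measure R]_(x in `[a, b]) f i x.
Proof.
elim: n f => [|n ih] f cf.
  under eq_Rintegral do rewrite big_ord0.
  by rewrite big_ord0 Rintegral_cst ?mul0r.
under eq_Rintegral do rewrite big_ord_recl.
rewrite big_ord_recl -ih => [|i x]; last exact: cf.
rewrite (@RintegralD_cc _ _ _ (f ord0) (fun x => \sum_i f (lift ord0 i) x)) //.
  exact: cf.
by move=> x xin; apply: cont_fun_sum => i; exact: cf.
Qed.

Lemma dotv0r (R : realType) n (u : 'cV[R]_n) : dotv u 0 = 0.
Proof. by rewrite -(scale0r u) dotvZr mul0r. Qed.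

(** The support is closed and lies in ]a, b[. Vanishing on a whole neighbourhood of a and of b, not
    just at these points, makes the derivatives of w vanish there too. *)
Lemma compact_support_near0 (R : realType) (V : normedModType R) (a b : R)
    (w : R -> V) (x : R) :
  smooth_compact_support a b w -> x \notin `]a, b[ -> \near x, w x = 0.
Proof.
move=> [_ _ sub] xab.
have N : (~` closure [set x | w x != 0]) x by move=> /sub /=; exact/negP.
have oN : open (~` closure [set x | w x != 0]).
  by apply: closed_openC; exact: closed_closure.
near=> y; apply/eqP/negPn/negP => wy.
have : (~` closure [set x | w x != 0]) y by near: y; exact: near_open.
by apply; exact: subset_closure.
Unshelve. all: by end_near. Qed.

Lemma compact_support_smooth (R : realType) (V : normedModType R) (a b : R)
    (w : R -> V) : smooth_compact_support a b w -> smooth setT w.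
Proof. by move=> [sw _ _]; split=> k x _; exact: sw. Qed.

(** Only one derivative is moved off w: the constraint concerns w', which is the effective test
    function from here on. The boundary terms contain w' at a and b, hence vanish. *)
Lemma first_variation_by_parts (R : realType) n (a b : R)
    (gamma : R -> 'cV[R]_n) (rho : R -> R) (U : set R) (w : R -> 'cV[R]_n) :
  a < b -> open U -> `[a, b] `<=` U -> smooth U gamma -> smooth U rho ->
  smooth_compact_support a b w ->
  \int[@lebesgue_measure R]_(x in `[a, b])
     (rho x * dotv (derive1 (derive1 gamma) x) (derive1 (derive1 w) x)) =
  - \int[@lebesgue_measure R]_(x in `[a, b])
     dotv (derive1 (fun y => rho y *: derive1 (derive1 gamma) y) x)
       (derive1 w x).
Proof.
move=> ab oU abU sg sr scw.
have sw := compact_support_smooth scw.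
set k := fun y => rho y *: derive1 (derive1 gamma) y.
have sk : smooth U k.
  by apply: smooth_scalemx => //; do 2!apply: smooth_derive1.
have w0 x : x \notin `]a, b[ -> derive1 w x = 0.
  move=> /(compact_support_near0 scw) w0.
  by rewrite (derive1_near (g := fun=> 0)) ?derive1_cst.
have dF x : x \in `[a, b] ->
    is_derive x 1 (fun x => dotv (k x) (derive1 w x))
      (dotv (derive1 k x) (derive1 w x) +
       rho x * dotv (derive1 (derive1 gamma) x) (derive1 (derive1 w) x)).
  move=> xin; rewrite -dotvZl; apply: is_derive_dotv.
    exact: smooth_is_derive sk (abU _ xin).
  exact: (@smooth_is_derive _ _ setT _ _ (smooth_derive1 sw) I).
have sw1 : smooth U (derive1 w).
  by apply: smooth_derive1; exact: (smooth_sub (@subsetT _ U) sw).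
have s1 : smooth U (fun x => dotv (derive1 k x) (derive1 w x)).
  exact: smooth_dotv oU (smooth_derive1 sk) sw1.
have s2 : smooth U (fun x =>
    rho x * dotv (derive1 (derive1 gamma) x) (derive1 (derive1 w) x)).
  exact: (smoothM oU sr (smooth_dotv oU (smooth_derive1 (smooth_derive1 sg))
    (smooth_derive1 sw1))).
have c1 x : x \in `[a, b] ->
    {for x, continuous (fun x => dotv (derive1 k x) (derive1 w x))}.
  by move=> /abU; exact: smooth_continuous.
have c2 x : x \in `[a, b] -> {for x, continuous (fun x =>
    rho x * dotv (derive1 (derive1 gamma) x) (derive1 (derive1 w) x))}.
  by move=> /abU; exact: smooth_continuous.
have F0 z : z \notin `]a, b[ -> dotv (k z) (derive1 w z) = 0.
  by move=> /w0 ->; exact: dotv0r.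
have E := Rintegral_FTC2 ab dF (fun x xin => cont_funD (c1 x xin) (c2 x xin)).
have Z : dotv (k b) (derive1 w b) - dotv (k a) (derive1 w a) = 0.
  have na : a \notin `]a, b[ by rewrite in_itv /= ltxx.
  have nb : b \notin `]a, b[ by rewrite in_itv /= ltxx andbF.
  exact: etrans (congr2 (fun u v => u - v) (F0 b nb) (F0 a na)) (subrr 0).
have := etrans (esym (RintegralD_cc c1 c2)) (etrans E Z).
by rewrite addrC => /eqP; rewrite addr_eq0 => /eqP.
Qed.

(** The first variation formula covers every variation with field w, so the weak identity suffices.
    Conversely the affine variation alone yields it, by uniqueness of the derivative. *)
Lemma elasticP (R : realType) n (a b : R) (gamma : R -> 'cV[R]_n)
    (rho : R -> R) :
  a < b -> arclength_parametrized a b gamma -> stiffness a b rho ->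
  elastic a b rho gamma <->
  forall w : R -> 'cV[R]_n, smooth_compact_support a b w ->
    (forall x, x \in `[a, b] -> dotv (derive1 w x) (derive1 gamma x) = 0) ->
    \int[@lebesgue_measure R]_(x in `[a, b])
      dotv (derive1 (fun y => rho y *: derive1 (derive1 gamma) y) x)
        (derive1 w x) = 0.
Proof.
move=> ab hg hr.
have [[[Ug [oUg abUg /Smooth sg]] _] _] := hg.
have [[Ur [oUr abUr /Smooth sr]] _] := hr.
have ibp w := @first_variation_by_parts R n a b gamma rho (Ug `&` Ur) w ab
  (openI oUg oUr) (fun x xin => conj (abUg x xin) (abUr x xin))
  (smooth_sub (@subIsetl _ _ _) sg) (smooth_sub (@subIsetr _ _ _) sr).
split=> [el w scw ortho|h w scw ortho eps G hG vf].
  have [hG vf] := affine_smooth_variation hg (compact_support_smooth scw) ortho.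
  have D0 := el w scw ortho _ _ hG (fun x _ => vf x).
  have D1 := first_variation ab hg hr (compact_support_smooth scw) ortho hG
    (fun x _ => vf x).
  have := derive1_val D1; rewrite (derive1_val D0) ibp // => /esym/eqP.
  by rewrite oppr_eq0 => /eqP.
have := first_variation ab hg hr (compact_support_smooth scw) ortho hG vf.
by rewrite ibp // h // oppr0.
Qed.

(** * The Lagrange multiplier *)

(** For a unit vector T, the orthogonal projection onto the complement of T. *)
Definition perp (R : realType) n (T u : 'cV[R]_n) : 'cV[R]_n :=
  u - dotv u T *: T.

Lemma dotv_perp (R : realType) n (T u : 'cV[R]_n) :
  dotv T T = 1 -> dotv (perp T u) T = 0.
Proof. by move=> T1; rewrite /perp !dotvE T1 mulr1 subrr. Qed.

Lemma dotv_perp_perp (R : realType) n (T u : 'cV[R]_n) :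
  dotv T T = 1 -> dotv u (perp T u) = dotv (perp T u) (perp T u).
Proof.
move=> T1; rewrite {3}/perp dotvDl dotvNl dotvZl (dotvC T) dotv_perp //.
by rewrite mulr0 subr0.
Qed.

Lemma smooth_perp (R : realType) n U (T V : R -> 'cV[R]_n) :
  open U -> smooth U T -> smooth U V -> smooth U (fun x => perp (T x) (V x)).
Proof.
move=> oU sT sV; apply: smoothB => //; apply: smooth_scalemx => //.
exact: smooth_dotv.
Qed.

(** [f] is smooth only near [a, b]. The product is smooth on U and identically 0 on the open
    complement of [a, b], and these two sets cover the line. *)
Lemma smooth_cutoff (R : realType) m n (U : set R) (a b : R) (psi : R -> R)
    (f : R -> 'M[R]_(m, n)) :
  open U -> `[a, b] `<=` U -> smooth setT psi -> smooth U f ->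
  (forall x, x \notin `]a, b[ -> psi x = 0) ->
  smooth setT (fun x => psi x *: f x).
Proof.
move=> oU abU spsi sf psi0.
have [s1] := smooth_scalemx oU (smooth_sub (@subsetT _ U) spsi) sf.
have oC : open (~` [set` `[a, b]]) by apply: closed_openC; exact: interval_closed.
have [s2] : smooth (~` [set` `[a, b]]) (fun x => psi x *: f x).
  apply: smooth_eq oC _ (@smooth_cst _ _ _ 0) => x xab.
  rewrite psi0 ?scale0r //; apply: contra_notN xab; exact: subset_itv_oo_cc.
split=> k x _; have [xab|xab] := boolP (x \in `[a, b]).
  by apply: s1; exact: abU.
by apply: s2; exact/negP.
Qed.

(** Writing d = f T with f = <d, T> and differentiating, 0 = f' T + f T'. As T' is orthogonal to T,
    f' = 0, and T' <> 0 leaves f = 0. *)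
Lemma constant_tangent_eq0 (R : realType) n (T : R -> 'cV[R]_n) (x : R) T' d :
  is_derive x 1 T T' -> T' != 0 -> (\near x, dotv (T x) (T x) = 1) ->
  (\near x, perp (T x) d = 0) -> d = 0.
Proof.
move=> dT T'0 T1 dperp.
have df := is_derive_dotv (@is_derive_cst R R _ d x 1) dT.
have /derive1_val := is_derive_scalemx df dT.
rewrite (@derive1_near R _ _ (fun=> d)); last first.
  near=> y; apply/esym/eqP; rewrite -subr_eq0; apply/eqP.
  by near: y.
rewrite derive1_cst dotvC dotv0r add0r => E.
have T1x := nbhs_singleton T1.
have : dotv (0 : 'cV[R]_n) (T x) = 0 by rewrite dotvC dotv0r.
rewrite {1}E !dotvE T1x (dotv_derive_unit dT T1) mulr0 addr0 mulr1 => dT'.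
move/esym/eqP : E; rewrite dT' scale0r add0r scaler_eq0 (negPf T'0) orbF.
move=> /eqP f0; have /eqP := nbhs_singleton dperp.
by rewrite /perp f0 scale0r subr0 => /eqP.
Unshelve. all: by end_near. Qed.

(** The zero means make the coordinatewise primitives vanish beyond b' as they do before a', so the
    support lies in [a', b'], with the margin inside ]a, b[ that compact support demands. *)
Lemma compact_support_primitive (R : realType) n (a b a' b' : R)
    (y : R -> 'cV[R]_n) :
  a < a' -> a' < b' -> b' < b -> smooth setT y ->
  (forall x, x \notin `]a', b'[ -> y x = 0) ->
  (forall i, \int[@lebesgue_measure R]_(x in `[a, b]) y x i 0 = 0) ->
  exists2 w, smooth_compact_support a b w & derive1 w = y.
Proof.
move=> aa' a'b' b'b sy y0 Iy.
have /choice [W hW] : forall i, exists W : R -> R,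
    [/\ smooth setT W, derive1 W = (fun x => y x i 0),
    forall x, x <= a' -> W x = 0 & forall x, b' <= x -> W x = 0].
  move=> i; have [||W [sW dW W0 W1]] :=
      smooth_primitive aa' a'b' b'b (smooth_coord i 0 openT sy).
  - by move=> x xa'; rewrite y0 ?mxE // in_itv /= ltNge xa'.
  - by move=> x b'x; rewrite y0 ?mxE // in_itv /= [x < b']ltNge b'x andbF.
  by exists W; split=> // x /W1 ->.
pose w x : 'cV[R]_n := \col_i W i x.
have wE i j x : w x i j = W i x by rewrite mxE.
have sw : smooth setT w.
  apply/(smooth_mxP _ openT) => i j; have [sW _ _ _] := hW i.
  by rewrite (_ : (fun x => _) = W i) //; apply/funext => x; rewrite wE.
have sub : [set x | w x != 0] `<=` `[a', b'].
  move=> x /= wx; rewrite in_itv /= !leNgt -negb_or; apply: contra wx.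
  move=> h; apply/eqP/matrixP => i j; rewrite wE mxE.
  by have [_ _ W0 W1] := hW i; case/orP : h => /ltW; [exact: W0|exact: W1].
have csub : closure [set x | w x != 0] `<=` `[a', b'].
  have cl : closed [set` `[a', b']] by exact: interval_closed.
  by rewrite [X in _ `<=` X]((closure_id _).1 cl); exact: closure_subset.
exists w.
  split.
  - by case: sw => sw k x; exact: sw.
  - apply: subclosed_compact csub; first exact: closed_closure.
    exact: segment_compact.
  - move=> x /csub /=; rewrite !in_itv /= => /andP[a'x xb'].
    by rewrite (lt_le_trans aa') // (le_lt_trans xb').
apply/funext => x; apply: derive1_val; apply/is_derive_mxP => i j.
have [sW dW _ _] := hW i; rewrite ord1.
rewrite (_ : (fun x => _) = W i); last by apply/funext => z; rewrite wE.
rewrite (_ : y x i 0 = derive1 (W i) x); last by rewrite dW.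
exact: (@smooth_is_derive R R setT (W i) x sW I).
Qed.

Lemma dotv_mulmx (R : realType) n (u v : 'cV[R]_n) : dotv u v = (u^T *m v) 0 0.
Proof. by rewrite mxE; apply: eq_bigr => i _; rewrite mxE. Qed.

Lemma Rintegral_dotv_cst (R : realType) n (a b : R) (c : 'cV[R]_n)
    (f : R -> 'cV[R]_n) :
  (forall x, x \in `[a, b] -> {for x, continuous f}) ->
  \int[@lebesgue_measure R]_(x in `[a, b]) dotv c (f x) =
  \sum_i c i 0 * \int[@lebesgue_measure R]_(x in `[a, b]) f x i 0.
Proof.
move=> cf; rewrite Rintegral_sum_cc.
  apply: eq_bigr => i _; apply: RintegralZ_cc => x xin.
  by apply: cont_fun_coord; exact: cf.
move=> i x xin; apply: cont_funM; first exact: cont_cst.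
by apply: cont_fun_coord; exact: cf.
Qed.

Lemma local_multiplier (R : realType) n (a b a' b' x0 : R) (U : set R)
    (T V : R -> 'cV[R]_n) :
  open U -> `[a, b] `<=` U -> smooth U T -> smooth U V ->
  (forall x, x \in `[a, b] -> dotv (T x) (T x) = 1) ->
  (forall w, smooth_compact_support a b w ->
     (forall x, x \in `[a, b] -> dotv (derive1 w x) (T x) = 0) ->
     \int[@lebesgue_measure R]_(x in `[a, b]) dotv (V x) (derive1 w x) = 0) ->
  a < a' -> x0 \in `]a', b'[ -> b' < b -> derive1 T x0 != 0 ->
  exists c, forall x, x \in `]a', b'[ -> perp (T x) (V x - c) = 0.
Proof.
move=> oU abU sT sV T1 hV aa' x0in b'b T'0.
have a'b' : a' < b' by move: x0in; rewrite in_itv /= => /andP[]; exact: lt_trans.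
have ooW x : x \in `]a', b'[ -> x \in `[a, b].
  by rewrite !in_itv /= => /andP[a'x xb'];
    rewrite !ltW // ?(lt_trans aa') // (lt_trans xb').
have ooab x : x \in `]a', b'[ -> x \in `]a, b[.
  by rewrite !in_itv /= => /andP[a'x xb']; rewrite (lt_trans aa') // (lt_trans xb').
have [psi spsi hpsi] := smooth_bump a' b'.
have psi0 x : x \notin `]a', b'[ -> psi x = 0.
  rewrite in_itv /= => xn; have [p0 pE] := hpsi x.
  by apply/eqP; rewrite eq_le p0 andbT leNgt pE.
have psi0' x : x \notin `]a, b[ -> psi x = 0.
  by move=> xn; apply: psi0; apply: contra xn; exact: ooab.
have sP (f : R -> 'cV[R]_n) : smooth U f ->
    smooth setT (fun x => psi x *: perp (T x) (f x)).
  move=> sf; apply: (smooth_cutoff oU abU spsi _ psi0').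
  exact: (smooth_perp oU sT sf).
have cP (f : R -> 'cV[R]_n) x : smooth U f -> x \in `[a, b] ->
    {for x, continuous (fun x => psi x *: perp (T x) (f x))}.
  by move=> /sP sf _; exact: (smooth_continuous sf I).
(* The integrand equals psi |perp(T, f)|^2, so a zero integral kills the normal part of f. Used both
   for a vector in the kernel of [M] and for V - c. *)
have vanish (f : R -> 'cV[R]_n) : smooth U f ->
    \int[@lebesgue_measure R]_(x in `[a, b])
       dotv (f x) (psi x *: perp (T x) (f x)) = 0 ->
    forall x, x \in `]a', b'[ -> perp (T x) (f x) = 0.
  move=> sf If x xin; have xab := ooW x xin.
  have E : dotv (f x) (psi x *: perp (T x) (f x)) = 0.
    apply: (@Rintegral_eq0_cc R a b (fun x => dotv (f x)
      (psi x *: perp (T x) (f x))) _ _ If x (ooab x xin)) => y yin.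
      apply: cont_fun_dotv; last exact: cP.
      exact: smooth_continuous sf (abU _ yin).
    rewrite dotvZr dotv_perp_perp ?T1 // mulr_ge0 ?dotv_ge0 //.
    by have [] := hpsi y.
  move/eqP : E; rewrite dotvZr dotv_perp_perp ?T1 // mulf_eq0 dotv_eq0.
  have [_ pE] := hpsi x; have : 0 < psi x by rewrite pE; move: xin; rewrite in_itv.
  by move=> /lt0r_neq0 /negPf -> /eqP.
(* [In i f] is coordinate i of the integral of psi perp(T, f), and [M] is the matrix of this map on
   constant vectors. *)
pose In i (f : R -> 'cV[R]_n) := \int[@lebesgue_measure R]_(x in `[a, b])
  (psi x *: perp (T x) (f x)) i 0.
pose M : 'M[R]_n := \matrix_(i, j) In i (fun=> delta_mx j 0).
have ME c i : (M *m c) i 0 = In i (fun=> c).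
  rewrite mxE; transitivity (\sum_j c j 0 * In i (fun=> delta_mx j 0)).
    by apply: eq_bigr => j _; rewrite mxE mulrC.
  have E j : c j 0 * In i (fun=> delta_mx j 0) =
      \int[@lebesgue_measure R]_(x in `[a, b])
        (c j 0 * (psi x *: perp (T x) (delta_mx j 0)) i 0).
    apply/esym/RintegralZ_cc => x xin.
    by apply: cont_fun_coord; apply: cP xin; exact: smooth_cst.
  rewrite (eq_bigr _ (fun j _ => E j)).
  rewrite -Rintegral_sum_cc; last first.
    move=> j x xin; apply: cont_funM; first exact: cont_cst.
    by apply: cont_fun_coord; apply: cP xin; exact: smooth_cst.
  have cE : c = \sum_j c j 0 *: delta_mx j 0.
    by rewrite {1}(matrix_sum_delta c); apply: eq_bigr => j _; rewrite big_ord1.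
  apply: eq_Rintegral => x _; rewrite [in RHS]cE.
  have perpZ (u : 'I_n -> R) (v : 'I_n -> 'cV[R]_n) :
      perp (T x) (\sum_j u j *: v j) = \sum_j u j *: perp (T x) (v j).
    rewrite /perp; elim/big_ind2: _ => [|u1 v1 u2 v2 <- <-|j _].
    - by rewrite dotvC dotv0r scale0r subr0.
    - by rewrite dotvDl scalerDl opprD addrACA.
    - by rewrite dotvZl scalerBr scalerA.
  rewrite perpZ scaler_sumr summxE; apply: eq_bigr => j _.
  by rewrite !mxE; ring.
have Munit : M \in unitmx.
  (* The invertibility criterion provides a row vector with v M = 0. Symmetry turns it into M d = 0,
     so the integral of psi |perp(T, d)|^2 is zero and d is tangent near x0. *)
  have Msym : M^T = M.
    apply/matrixP => i j; rewrite !mxE; apply: eq_Rintegral => x _.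
    rewrite !mxE eqxx !andbT (eq_sym i).
    congr (_ * (_ - _)).
    have dE k : dotv (delta_mx k 0) (T x) = T x k 0.
      rewrite /dotv (bigD1 k) //= mxE !eqxx mul1r big1 ?addr0 // => l lk.
      by rewrite mxE (negPf lk) mul0r.
    by rewrite !dE mulrC.
  rewrite -row_free_unit -kermx_eq0; apply/rowV0P => v /sub_kermxP vM.
  have Md : M *m v^T = 0 by rewrite -[M]Msym -trmx_mul vM trmx0.
  apply: trmx_inj; rewrite trmx0; set d := v^T in Md *.
  have sd : smooth U (fun _ : R => d) by exact: smooth_cst.
  have dperp := vanish _ sd.
  apply: (constant_tangent_eq0 (smooth_is_derive sT (abU _ (ooW _ x0in))) T'0).
    by apply: near_itv_oo x0in _ => y /ooW; exact: T1.
  apply: near_itv_oo x0in _; apply: dperp.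
  rewrite Rintegral_dotv_cst => [|x xin]; last exact: cP.
  by rewrite big1 // => i _; have := ME d i; rewrite Md mxE /In => <-; rewrite mulr0.
(* M c = r makes the mean of y below vanish, so that y is the derivative of an
   admissible field. *)
pose r : 'cV[R]_n := \col_i In i V.
exists (invmx M *m r); set c := invmx M *m r.
have sVc : smooth U (fun x => V x - c) by apply: smoothB => //; exact: smooth_cst.
apply: vanish => //.
set y := fun x => psi x *: perp (T x) (V x - c).
have Iy i : \int[@lebesgue_measure R]_(x in `[a, b]) y x i 0 = 0.
  have E x : y x i 0 = (psi x *: perp (T x) (V x)) i 0 +
      (-1) * (psi x *: perp (T x) c) i 0.
    by rewrite /y /perp dotvDl dotvNl !mxE; ring.
  under eq_Rintegral do rewrite E.
  rewrite RintegralD_cc ?RintegralZ_cc.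
  - have := ME c i; rewrite mulKVmx // mxE /In => ->.
    by rewrite mulN1r subrr.
  - by move=> x xin; apply: cont_fun_coord; apply: cP xin; exact: smooth_cst.
  - by move=> x xin; apply: cont_fun_coord; exact: cP.
  - move=> x xin; apply: cont_funM; first exact: cont_cst.
    by apply: cont_fun_coord; apply: cP xin; exact: smooth_cst.
have [|w scw dw] := compact_support_primitive aa' a'b' b'b (sP _ sVc) _ Iy.
  by move=> x /psi0 ->; rewrite scale0r.
have := hV w scw; rewrite dw => /(_ _) IV.
have {}IV : \int[@lebesgue_measure R]_(x in `[a, b]) dotv (V x) (y x) = 0.
  by apply: IV => x xin; rewrite dotvZl dotv_perp ?mulr0 // T1.
have cy x : x \in `[a, b] -> {for x, continuous y} by exact: cP.
(* A constant pairs to zero with the mean-zero field [y], so V may be replaced by V - c in the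
   tested identity. *)
have Ic : \int[@lebesgue_measure R]_(x in `[a, b]) dotv (- c) (y x) = 0.
  rewrite Rintegral_dotv_cst // big1 // => i _; by rewrite Iy mulr0.
have E x : dotv (V x - c) (y x) = dotv (V x) (y x) + dotv (- c) (y x).
  by rewrite dotvDl.
transitivity (\int[@lebesgue_measure R]_(x in `[a, b])
    (dotv (V x) (y x) + dotv (- c) (y x))).
  by apply: eq_Rintegral => x _; exact: E.
rewrite RintegralD_cc; first by rewrite IV Ic addr0.
  move=> x xin; apply: cont_fun_dotv; last exact: cy.
  exact: smooth_continuous sV (abU _ xin).
by move=> x xin; apply: cont_fun_dotv; [exact: cvg_cst|exact: cy].
Qed.

Lemma perpD (R : realType) n (T u v : 'cV[R]_n) :
  perp T (u + v) = perp T u + perp T v.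
Proof. by rewrite /perp dotvDl scalerDl opprD addrACA. Qed.

Lemma perpN (R : realType) n (T u : 'cV[R]_n) : perp T (- u) = - perp T u.
Proof. by rewrite /perp dotvNl scaleNr opprB opprK addrC. Qed.

(** Each x of ]a, b[ lies together with x0 in some ]a', b'[, which provides a local constant. Two
    such constants differ by a vector tangent to the curve near x0, hence coincide; no limit over
    growing intervals is taken. *)
Lemma global_multiplier (R : realType) n (a b x0 : R) (U : set R)
    (T V : R -> 'cV[R]_n) :
  open U -> `[a, b] `<=` U -> smooth U T -> smooth U V ->
  (forall x, x \in `[a, b] -> dotv (T x) (T x) = 1) ->
  (forall w, smooth_compact_support a b w ->
     (forall x, x \in `[a, b] -> dotv (derive1 w x) (T x) = 0) ->
     \int[@lebesgue_measure R]_(x in `[a, b]) dotv (V x) (derive1 w x) = 0) ->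
  x0 \in `]a, b[ -> derive1 T x0 != 0 ->
  exists c, forall x, x \in `]a, b[ -> perp (T x) (V x - c) = 0.
Proof.
move=> oU abU sT sV T1 hV x0in T'0.
have [ax0 x0b] : a < x0 /\ x0 < b by move: x0in; rewrite in_itv => /andP.
have local x : x \in `]a, b[ -> exists c, perp (T x) (V x - c) = 0 /\
    \near x0, perp (T x0) (V x0 - c) = 0.
  rewrite in_itv /= => /andP[ax xb].
  have [a' [aa' a'x a'x0]] : exists a', [/\ a < a', a' < x & a' < x0].
    have m : a < Num.min x x0 by rewrite lt_min ax.
    exists ((a + Num.min x x0) / 2); rewrite midf_lt //.
    by split=> //; apply: lt_le_trans (midf_lt m).2 _; rewrite ge_min lexx ?orbT.
  have [b' [b'b xb' x0b']] : exists b', [/\ b' < b, x < b' & x0 < b'].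
    have m : Num.max x x0 < b by rewrite gt_max xb.
    exists ((Num.max x x0 + b) / 2); rewrite midf_lt //.
    by split=> //; apply: le_lt_trans _ (midf_lt m).1; rewrite le_max lexx ?orbT.
  have x0in' : x0 \in `]a', b'[ by rewrite in_itv /= a'x0.
  have [c hc] := local_multiplier oU abU sT sV T1 hV aa' x0in' b'b T'0.
  exists c; split; first by apply: hc; rewrite in_itv /= a'x.
  exact: near_itv_oo x0in' hc.
have [c [_ hc]] := local x0 x0in.
exists c => x xin; have [c' [hx hc']] := local x xin.
suff <- : c' = c by [].
apply/eqP; rewrite -subr_eq0; apply/eqP.
apply: (constant_tangent_eq0 (smooth_is_derive sT (abU _ (subset_itv_oo_cc x0in))) T'0).
  by apply: near_itv_oo x0in _ => y /subset_itv_oo_cc; exact: T1.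
near=> y; have -> : c' - c = (V y - c) - (V y - c') by rewrite opprB [RHS]addrC subrKA.
rewrite perpD perpN (_ : perp _ (V y - c) = 0); last by near: y.
by rewrite (_ : perp _ (V y - c') = 0) ?subrr //; near: y.
Unshelve. all: by end_near. Qed.

(** * Hadamard's inequality *)

Definition posdef (R : realType) n (A : 'M[R]_n) : Prop :=
  A^T = A /\ forall x : 'cV[R]_n, x != 0 -> 0 < (x^T *m A *m x) 0 0.

Lemma posdef_diag (R : realType) n (A : 'M[R]_n) i : posdef A -> 0 < A i i.
Proof.
move=> [_ /(_ (delta_mx i 0))].
have -> : ((delta_mx i 0)^T *m A *m delta_mx i 0 : 'M[R]_1) 0 0 = A i i.
  by rewrite -colE trmx_delta -rowE !mxE.
apply; apply/eqP => /matrixP /(_ i 0); rewrite !mxE !eqxx /=.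
by move/eqP; rewrite oner_eq0.
Qed.

Lemma prodr_eq_le (R : realType) n (F G : 'I_n -> R) :
  (forall i, 0 < F i <= G i) -> \prod_i F i = \prod_i G i ->
  forall i, F i = G i.
Proof.
move=> FG E i; have [Fi FGi] := andP (FG i).
apply/eqP; rewrite eq_le FGi /=.
have G0 : 0 < \prod_(j | j != i) G j.
  by apply: prodr_gt0 => j _; have /andP[Fj Gj] := FG j; exact: lt_le_trans Gj.
rewrite -(ler_pM2r G0); move: E; rewrite (bigD1 i) //= [in RHS](bigD1 i) //= => <-.
rewrite ler_pM2l //; apply: ler_prod => j _; have /andP[Fj Gj] := FG j.
by rewrite (ltW Fj).
Qed.

(* By induction through the Schur complement of the first diagonal entry. *)
Lemma hadamard_posdef (R : realType) n (A : 'M[R]_n) : posdef A ->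
  [/\ 0 < \det A, \det A <= \prod_i A i i &
      \det A = \prod_i A i i -> forall i j, i != j -> A i j = 0].
Proof.
elim: n A => [|n ih] A pA.
  by rewrite det_mx00 big_ord0; split=> // _ [].
pose al := A 0 0; have al0 : 0 < al by exact: posdef_diag.
pose A' : 'M[R]_(1 + n) := A.
pose u := ursubmx A'; pose B := drsubmx A'.
have pA' : posdef A' := pA.
have [sA hA] := pA'.
have ulE : ulsubmx A' = al%:M.
  by apply/matrixP => i j; rewrite !ord1 !mxE eqxx mulr1n; congr (A _ _); exact/val_inj.
have dlE : dlsubmx A' = u^T by rewrite /u trmx_ursub sA.
have AE : A' = block_mx al%:M u u^T B by rewrite -ulE -dlE submxK.
pose S := B - al^-1 *: (u^T *m u).
have detA : \det A = al * \det S.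
  (* Block Gaussian elimination: a unipotent lower factor times an upper one with diagonal blocks
     [al] and [S]. *)
  transitivity (\det (block_mx 1%:M 0 (al^-1 *: u^T) 1%:M *m
      block_mx al%:M u 0 S : 'M[R]_(1 + n))).
    rewrite mulmx_block !mul1mx !mul0mx !addr0 -[\det A]/(\det A') AE.
    congr (\det (block_mx _ _ _ _)); last by rewrite -scalemxAl addrC subrK.
    by rewrite -scalemxAl mul_mx_scalar scalerA mulVf ?scale1r ?gt_eqF.
  by rewrite det_mulmx det_lblock det_ublock !det1 det_scalar1 !mul1r.
have pS : posdef S.
  split.
    have sB : B^T = B by rewrite /B trmx_drsub sA.
    by rewrite /S linearB linearZ /= trmx_mul trmxK sB.
  move=> y y0.
  (* The first entry is chosen so that the first entry of A x vanishes; the form of A at x is then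
     that of S at y. *)
  pose x : 'cV[R]_(1 + n) := col_mx (- (al^-1 *: (u *m y))) y.
  have : x != 0.
    by apply: contraNneq y0 => /eqP; rewrite col_mx_eq0 => /andP[].
  move/hA; rewrite AE /x tr_col_mx mul_row_block mul_row_col.
  have -> : (- (al^-1 *: (u *m y)))^T *m al%:M + y^T *m u^T = 0.
    rewrite linearN linearZ /= trmx_mul mulNmx mul_mx_scalar scalerA.
    by rewrite mulfV ?gt_eqF // scale1r addNr.
  rewrite mul0mx add0r; congr (0 < fun_of_matrix _ 0 0).
  rewrite /S mulmxBr mulmxBl mulmxDl addrC; congr (_ + _).
  rewrite linearN linearZ /= trmx_mul !mulNmx -!scalemxAl -scalemxAr -scalemxAl.
  by rewrite !mulmxA.
have SE i : S i i = A (lift ord0 i) (lift ord0 i) - al^-1 * (u 0 i) ^+ 2.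
  rewrite !mxE big_ord1 !mxE; congr (A _ _ - _ * _); exact/val_inj.
have SA i : 0 < S i i <= A (lift ord0 i) (lift ord0 i).
  by rewrite posdef_diag //= SE gerBl mulr_ge0 ?sqr_ge0 // invr_ge0 ltW.
have [S0 Sle Seq] := ih S pS.
have le2 : \prod_i S i i <= \prod_i A (lift ord0 i) (lift ord0 i).
  by apply: ler_prod => i _; have /andP[/ltW -> ->] := SA i.
rewrite detA big_ord_recl -/al; split.
- exact: mulr_gt0.
- by rewrite ler_pM2l // (le_trans Sle).
(* Equality forces the products of the S_ii and of the corresponding A_ii to agree, hence the
   factors one by one, so the subtracted squares u_i^2 / al are all zero. *)
move/(mulfI (lt0r_neq0 al0)) => E.
have E1 : \prod_i S i i = \prod_i A (lift ord0 i) (lift ord0 i).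
  by apply/eqP; rewrite eq_le le2 -E.
have u0 : u = 0.
  apply/matrixP => k i; rewrite ord1 [RHS]mxE.
  have := prodr_eq_le SA E1 i; rewrite SE => /eqP.
  rewrite -subr_eq0 addrAC subrr add0r oppr_eq0 mulf_eq0 invr_eq0 gt_eqF //=.
  by rewrite sqrf_eq0 => /eqP.
have BS : S = B by rewrite /S u0 trmx0 mul0mx scaler0 subr0.
have {}Seq := Seq (etrans E (esym E1)).
suff h (i j : 'I_(1 + n)) : i != j -> A' i j = 0 by exact: h.
rewrite AE u0 trmx0 -BS.
case: (split_ordP i) => i' ->; case: (split_ordP j) => j' -> ij.
- by move: ij; rewrite !ord1 eqxx.
- by rewrite block_mxEur mxE.
- by rewrite block_mxEdl mxE.
- by rewrite block_mxEdr Seq //; apply: contraNneq ij => ->.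
Qed.

(** The Gram matrix P^T P has unit diagonal and determinant 1, so it attains equality in Hadamard's
    inequality and its off-diagonal entries vanish. *)
Lemma unit_columns_orthogonal (R : realType) n (P : 'M[R]_n) :
  (forall j, dotv (col j P) (col j P) = 1) -> \det P = 1 -> P^T *m P = 1%:M.
Proof.
move=> P1 dP.
have Pu : P \in unitmx by rewrite unitmxE dP unitr1.
have E i j : (P^T *m P) i j = dotv (col i P) (col j P).
  by rewrite mxE; apply: eq_bigr => k _; rewrite !mxE.
have pA : posdef (P^T *m P).
  split; first by rewrite trmx_mul trmxK.
  move=> x x0; rewrite mulmxA -mulmxA -trmx_mul.
  have -> : ((P *m x)^T *m (P *m x)) 0 0 = dotv (P *m x) (P *m x).
    by rewrite mxE; apply: eq_bigr => k _; rewrite mxE.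
  rewrite dotv_gt0; apply: contraNneq x0 => Px.
  by rewrite -(mulKmx Pu x) Px mulmx0.
have [_ _ h] := hadamard_posdef pA.
apply/matrixP => i j; rewrite !mxE; have [<-|ij] := eqVneq i j.
  by have := E i i; rewrite mxE P1 => ->.
have := h _ i j ij; rewrite mxE => -> //.
rewrite det_mulmx det_tr dP mulr1 big1 // => k _.
by rewrite E P1.
Qed.

(** * Parallel frames and the curvature equations *)

(** Both orders of the product count: P^T P = 1 contains N^T N = 1 as a diagonal block, while P P^T
    = 1 reads T T^T + N N^T = 1, so N N^T is the normal projection. *)
Lemma mx_frame (R : realType) m (T : 'cV[R]_m.+1) (N : 'M[R]_(m.+1, m)) :
  dotv T T = 1 -> (forall j, dotv (col j N) (col j N) = 1) ->
  \det (row_mx T N : 'M[R]_m.+1) = 1 ->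
  N^T *m N = 1%:M /\ forall u, perp T u = N *m (N^T *m u).
Proof.
move=> T1 N1 dP; pose P : 'M[R]_(1 + m) := row_mx T N.
have P1 (j : 'I_(1 + m)) : dotv (col j P) (col j P) = 1.
  case: (split_ordP j) => k ->; last by rewrite colKr N1.
  by rewrite colKl ord1 [col _ _](_ : _ = T) //; apply/colP => i; rewrite mxE.
have PP : P^T *m P = 1%:M := unit_columns_orthogonal P1 dP.
have := PP; rewrite /P tr_row_mx mul_col_row (scalar_mx_block 1 m).
move=> /eq_block_mx[_ _ _ NN]; split=> // u.
have := mulmx1C PP; rewrite /P tr_row_mx mul_row_col => E.
have TT : T *m T^T *m u = dotv u T *: T.
  rewrite -mulmxA [T^T *m u]mx11_scalar mul_mx_scalar; congr (_ *: T).
  by rewrite dotvC dotv_mulmx.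
by rewrite /perp -TT -{1}[u]mul1mx -E mulmxDl addrC addKr mulmxA.
Qed.

Lemma frame_orthogonal (R : realType) m (a b : R) (gamma : R -> 'cV[R]_m.+1)
    (N : R -> 'M[R]_(m.+1, m)) (x : R) :
  arclength_parametrized a b gamma -> parallel_frame a b gamma N ->
  x \in `[a, b] ->
  (N x)^T *m N x = 1%:M /\
  forall u, perp (derive1 gamma x) u = N x *m ((N x)^T *m u).
Proof.
move=> [_ g1] [_ N1 dN] xin; apply: mx_frame.
- exact: enorm1 (g1 x xin).
- by move=> j; exact: enorm1 (N1 j x xin).
by have := dN x xin; rewrite /tangent /dds g1 // invr1 scale1r.
Qed.

Lemma frame_derive (R : realType) m (a b : R) (gamma : R -> 'cV[R]_m.+1)
    (N : R -> 'M[R]_(m.+1, m)) (kappa : R -> 'cV[R]_m) (x : R) :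
  arclength_parametrized a b gamma -> parallel_frame a b gamma N ->
  curvature_function a b gamma N kappa -> x \in `]a, b[ ->
  is_derive x 1 (derive1 gamma) (- (N x *m kappa x)) /\
  is_derive x 1 N (derive1 gamma x *m (kappa x)^T).
Proof.
move=> hg hN [_ hk] xin; have xab := subset_itv_oo_cc xin.
have [NN _] := frame_orthogonal hg hN xab.
have [[[U [oU abU /Smooth sg]] _] g1] := hg.
have tE y : y \in `[a, b] -> tangent gamma y = derive1 gamma y.
  by move=> yin; rewrite /tangent /dds g1 // invr1 scale1r.
have tn : \near x, derive1 gamma x = tangent gamma x.
  by apply: near_itv_oo xin _ => y /subset_itv_oo_cc /tE.
have dT : is_derive x 1 (derive1 gamma) (- (N x *m kappa x)).
  rewrite -hk // -(derive1_near tn).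
  exact: smooth_is_derive (smooth_derive1 sg) (abU _ xab).
split=> //; apply/is_derive_mxP => i j.
have [hpar _ _] := hN.
have [[[Uj [oUj abUj /Smooth sN]] orth] [lam _ dN]] := hpar j.
have dNj := smooth_is_derive sN (abUj _ xab).
(* Differentiating <N_j, T> = 0 gives lambda = <N_j', T> = - <N_j, T'> = (N^T N kappa)_j =
   kappa_j. *)
have lamE : lam x = kappa x j 0.
  have := derive1_val (is_derive_dotv dNj dT).
  rewrite (@derive1_near R R _ (fun=> 0)); last first.
    by apply: near_itv_oo xin _ => y /subset_itv_oo_cc yin; rewrite -tE ?orth.
  rewrite derive1_cst dN // tE // dotvZl (enorm1 (g1 x xab)) mulr1 dotvNr.
  move/esym/eqP; rewrite subr_eq0 => /eqP ->.
  rewrite -[kappa x in RHS]mul1mx -NN -mulmxA [RHS]mxE.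
  by apply: eq_bigr => k _; rewrite !mxE.
move: dNj => /is_derive_mxP /(_ i 0); rewrite dN // tE // lamE.
rewrite (_ : (fun y => _) = fun y => N y i j); last first.
  by apply/funext => y; rewrite mxE.
by rewrite !mxE big_ord1 !mxE mulrC.
Qed.

Lemma tr_frame_perp (R : realType) m (T u : 'cV[R]_m.+1) (N : 'M[R]_(m.+1, m)) :
  N^T *m N = 1%:M -> (forall u, perp T u = N *m (N^T *m u)) ->
  perp T u = 0 <-> N^T *m u = 0.
Proof.
move=> NN h; rewrite h; split=> [E|->]; last by rewrite mulmx0.
by rewrite -[N^T *m u]mul1mx -NN -mulmxA E mulmx0.
Qed.

Lemma dotv_mulmxl (R : realType) m n (A : 'M[R]_(m, n)) (u : 'cV[R]_n)
    (v : 'cV[R]_m) : dotv (A *m u) v = dotv u (A^T *m v).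
Proof. by rewrite !dotv_mulmx trmx_mul mulmxA. Qed.

Lemma mulmx_dotv (R : realType) n p (u : 'cV[R]_p) (v w : 'cV[R]_n) :
  u *m v^T *m w = dotv v w *: u.
Proof.
by rewrite -mulmxA [v^T *m w]mx11_scalar mul_mx_scalar -dotv_mulmx.
Qed.

(** * The derivative of rho T' and the curvature equations *)

Lemma force_derive (R : realType) m (a b : R) (gamma : R -> 'cV[R]_m.+1)
    (rho : R -> R) (N : R -> 'M[R]_(m.+1, m)) (kappa : R -> 'cV[R]_m) (x : R) :
  arclength_parametrized a b gamma -> parallel_frame a b gamma N ->
  curvature_function a b gamma N kappa -> x \in `]a, b[ ->
  derivable (fun y => rho y *: kappa y) x 1 ->
  derive1 (fun y => rho y *: derive1 (derive1 gamma) y) x =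
  - ((rho x * dotv (kappa x) (kappa x)) *: derive1 gamma x +
     N x *m derive1 (fun y => rho y *: kappa y) x).
Proof.
move=> hg hN hk xin du.
rewrite (derive1_near (g := fun y => - (N y *m (rho y *: kappa y)))); last first.
  apply: near_itv_oo xin _ => y yin.
  have [dT _] := frame_derive hg hN hk yin.
  by rewrite (derive1_val dT) scalerN -scalemxAr.
have [_ dN] := frame_derive hg hN hk xin.
apply: derive1_val; apply: is_deriveN.
have := is_derive_mulmx dN (derivable1P du).
by rewrite mulmx_dotv dotvZr.
Qed.


(** The first equation dictates [Lambda]: from (rho kappa)' = - N^T c and (N^T)' = kappa T^T follows
    (rho kappa)'' = - <T, c> kappa. *)
Lemma multiplier_ode (R : realType) m (a b : R) (gamma : R -> 'cV[R]_m.+1)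
    (rho : R -> R) (N : R -> 'M[R]_(m.+1, m)) (kappa : R -> 'cV[R]_m)
    (U : set R) (c : 'cV[R]_m.+1) :
  a < b -> open U -> `[a, b] `<=` U -> smooth U gamma -> smooth U rho ->
  smooth U kappa ->
  arclength_parametrized a b gamma -> parallel_frame a b gamma N ->
  curvature_function a b gamma N kappa ->
  (forall x, x \in `]a, b[ -> perp (derive1 gamma x)
     (derive1 (fun y => rho y *: derive1 (derive1 gamma) y) x - c) = 0) ->
  exists2 Lambda : R -> R, smooth U Lambda &
    forall x, x \in `[a, b] ->
      0 = derive1 (derive1 (fun y => rho y *: kappa y)) x
          + (2^-1 * rho x * dotv (kappa x) (kappa x)) *: kappa x
          - Lambda x *: kappa x
      /\
      0 = derive1 Lambda x + 2^-1 * derive1 rho x * dotv (kappa x) (kappa x).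
Proof.
move=> ab oU abU sg sr sk hg hN hk hc.
set rk := fun y => rho y *: kappa y.
have srk : smooth U rk by exact: smooth_scalemx.
have s2rho : smooth U (fun x => 2^-1 * rho x).
  exact: (smoothM oU (@smooth_cst R R U 2^-1) sr).
have skk : smooth U (fun x => dotv (kappa x) (kappa x)) by exact: smooth_dotv.
have srkk : smooth U (fun x => 2^-1 * rho x * dotv (kappa x) (kappa x)).
  exact: smoothM.
have sTc : smooth U (fun x => dotv (derive1 gamma x) (- c)).
  by apply: smooth_dotv => //; [exact: smooth_derive1|exact: smooth_cst].
pose Lambda x := 2^-1 * rho x * dotv (kappa x) (kappa x) +
  dotv (derive1 gamma x) (- c).
have sL : smooth U Lambda by exact: smoothD.
have uE x : x \in `]a, b[ -> derive1 rk x = - ((N x)^T *m c).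
  move=> xin; have xab := subset_itv_oo_cc xin.
  have [NN hP] := frame_orthogonal hg hN xab.
  have /(tr_frame_perp _ NN hP) := hc x xin.
  have drk : derivable rk x 1 by have [] := smooth_is_derive srk (abU _ xab).
  rewrite (force_derive hg hN hk xin drk) -/rk mulmxBr mulmxN mulmxDr mulmxA NN.
  have NT : (N x)^T *m derive1 gamma x = 0.
    apply/(tr_frame_perp _ NN hP).
    by rewrite /perp (enorm1 (hg.2 x xab)) scale1r subrr.
  rewrite -scalemxAr NT scaler0 add0r mul1mx => /eqP.
  by rewrite -opprD oppr_eq0 addr_eq0 => /eqP.
have ode1 x : x \in `]a, b[ -> derive1 (derive1 rk) x
    + (2^-1 * rho x * dotv (kappa x) (kappa x)) *: kappa x
    - Lambda x *: kappa x = 0.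
  move=> xin.
  rewrite (derive1_near (f := derive1 rk) (g := fun y => - ((N y)^T *m c))).
    have [_ dN] := frame_derive hg hN hk xin.
    have dc := is_deriveN (is_derive_mulmx (is_derive_trmx dN)
      (@is_derive_cst R R _ c x 1)).
    rewrite (derive1_val dc) mulmx0 addr0 trmx_mul trmxK mulmx_dotv.
    rewrite /Lambda scalerDl opprD addrA addrK dotvNr scaleNr opprK.
    by rewrite addrC subrr.
  exact: near_itv_oo xin uE.
have ode2 x : x \in `]a, b[ ->
    derive1 Lambda x + 2^-1 * derive1 rho x * dotv (kappa x) (kappa x) = 0.
  move=> xin; have xab := subset_itv_oo_cc xin; have Ux := abU _ xab.
  have [dT _] := frame_derive hg hN hk xin.
  have dr := smooth_is_derive sr Ux; have dk := smooth_is_derive sk Ux.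
  have dL := is_derive1D (is_derive1M (is_derive1M (@is_derive_cst R R R 2^-1 x 1)
    dr) (is_derive_dotv dk dk))
    (is_derive_dotv dT (@is_derive_cst R R _ (- c) x 1)).
  rewrite (derive1_val dL) dotv0r addr0 mul0r add0r.
  (* As N^T c = - (rho kappa)', the term <T', -c> of the derivative of [Lambda] is - <kappa, (rho
     kappa)'>. Added to the derivative of rho |kappa|^2 / 2, it leaves - rho' |kappa|^2 / 2. *)
  have E : dotv (- (N x *m kappa x)) (- c) =
      - (derive1 rho x * dotv (kappa x) (kappa x) +
         rho x * dotv (kappa x) (derive1 kappa x)).
    rewrite dotvNl dotv_mulmxl mulmxN -uE //.
    by rewrite (derive1_val (is_derive_scalemx dr dk)) dotvDr !dotvZr.
  rewrite E [dotv (derive1 kappa x) _]dotvC.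
  have F (p r' r q : R) : 2^-1 * r' * q + 2^-1 * r * (p + p) -
      (r' * q + r * p) + 2^-1 * r' * q = 0 by field.
  exact: F.
have aab : a \in `[a, b] by rewrite in_itv /= lexx ltW.
have bab : b \in `[a, b] by rewrite in_itv /= lexx ltW.
exists Lambda => // x xin; split.
  have s1 : smooth U (fun x => derive1 (derive1 rk) x
      + (2^-1 * rho x * dotv (kappa x) (kappa x)) *: kappa x
      - Lambda x *: kappa x).
    apply: smoothB => //; last exact: smooth_scalemx.
    apply: smoothD => //; last exact: smooth_scalemx.
    by do 2!apply: smooth_derive1.
  have s0 : smooth U (fun _ : R => 0 : 'cV[R]_m) by exact: smooth_cst.
  apply: (continuous_eq_cc ab (smooth_continuous s0 (abU _ aab))
    (smooth_continuous s0 (abU _ bab)) (smooth_continuous s1 (abU _ aab))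
    (smooth_continuous s1 (abU _ bab)) _ xin) => y yin.
  by rewrite ode1.
have s1 : smooth U (fun x =>
    derive1 Lambda x + 2^-1 * derive1 rho x * dotv (kappa x) (kappa x)).
  apply: smoothD => //; first exact: smooth_derive1.
  exact: (smoothM oU (smoothM oU (@smooth_cst R R U 2^-1) (smooth_derive1 sr))
    skk).
have s0 : smooth U (fun _ : R => 0 : R) by exact: smooth_cst.
apply: (continuous_eq_cc ab (smooth_continuous s0 (abU _ aab))
  (smooth_continuous s0 (abU _ bab)) (smooth_continuous s1 (abU _ aab))
  (smooth_continuous s1 (abU _ bab)) _ xin) => y yin.
by rewrite ode2.
Qed.

(** If T' vanishes throughout ]a, b[, then V = 0 there and c = 0 works; otherwise a point with T' <>
    0 starts the construction. Conversely <V, w'> = <c, w'> because w' is normal to T, and this is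
    the derivative of <c, w>, which is zero at both ends. *)
Lemma elastic_multiplier (R : realType) n (a b : R) (gamma : R -> 'cV[R]_n)
    (rho : R -> R) :
  a < b -> arclength_parametrized a b gamma -> stiffness a b rho ->
  elastic a b rho gamma <->
  exists c, forall x, x \in `]a, b[ -> perp (derive1 gamma x)
    (derive1 (fun y => rho y *: derive1 (derive1 gamma) y) x - c) = 0.
Proof.
move=> ab hg hr; rewrite elasticP //.
have [[[Ug [oUg abUg /Smooth sg]] _] g1] := hg.
have [[Ur [oUr abUr /Smooth sr]] _] := hr.
pose U := Ug `&` Ur; have oU : open U by exact: openI.
have abU : `[a, b] `<=` U by move=> x xin; split; [exact: abUg|exact: abUr].
have {}sg : smooth U gamma := smooth_sub (@subIsetl _ _ _) sg.
have {}sr : smooth U rho := smooth_sub (@subIsetr _ _ _) sr.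
have sT := smooth_derive1 sg; have sK := smooth_derive1 sT.
have sV : smooth U (derive1 (fun y => rho y *: derive1 (derive1 gamma) y)).
  by apply: smooth_derive1; exact: smooth_scalemx.
have T1 x : x \in `[a, b] -> dotv (derive1 gamma x) (derive1 gamma x) = 1.
  by move=> xin; exact: enorm1 (g1 x xin).
set V := derive1 _ in sV *; split=> [h|[c hc] w scw ortho].
  have [[x0 [x0in K0]]|K0] := pselect (exists x0,
      (x0 \in `]a, b[) /\ derive1 (derive1 gamma) x0 != 0).
    exact: global_multiplier oU abU sT sV T1 h x0in K0.
  exists 0 => x xin; rewrite subr0 /V.
  rewrite (derive1_near (f := fun y => rho y *: derive1 (derive1 gamma) y)
    (g := fun=> 0)).
    by rewrite derive1_cst /perp dotvC dotv0r scale0r subr0.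
  apply: near_itv_oo xin _ => y yin.
  have [->|Ky] := eqVneq (derive1 (derive1 gamma) y) 0.
    by rewrite scaler0.
  by case: K0; exists y.
have sw := compact_support_smooth scw.
have sw1 : smooth U (derive1 w) := smooth_derive1 (smooth_sub (@subsetT _ U) sw).
have s1 : smooth U (fun x => dotv (V x) (derive1 w x)) by exact: smooth_dotv.
have s2 : smooth U (fun x => dotv c (derive1 w x)).
  exact: (smooth_dotv oU (@smooth_cst _ _ U c) sw1).
have aab : a \in `[a, b] by rewrite in_itv /= lexx ltW.
have bab : b \in `[a, b] by rewrite in_itv /= lexx ltW.
have E x : x \in `]a, b[ -> dotv (V x) (derive1 w x) = dotv c (derive1 w x).
  move=> xin; apply/eqP; rewrite -subr_eq0 -dotvNl -dotvDl.
  move/eqP : (hc x xin); rewrite /perp subr_eq0 => /eqP ->.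
  rewrite dotvZl mulf_eq0; apply/orP; right; rewrite dotvC; apply/eqP.
  exact/ortho/subset_itv_oo_cc.
have Ecc := continuous_eq_cc ab (smooth_continuous s1 (abU _ aab))
  (smooth_continuous s1 (abU _ bab)) (smooth_continuous s2 (abU _ aab))
  (smooth_continuous s2 (abU _ bab)) E.
transitivity (\int[@lebesgue_measure R]_(x in `[a, b]) dotv c (derive1 w x)).
  by apply: eq_Rintegral => x /set_mem; exact: Ecc.
have dF x : x \in `[a, b] ->
    is_derive x 1 (fun x => dotv c (w x)) (dotv c (derive1 w x)).
  move=> _; have := is_derive_dotv (@is_derive_cst R R _ c x 1)
    (@smooth_is_derive _ _ setT _ x sw I).
  by rewrite dotvC dotv0r add0r.
rewrite (Rintegral_FTC2 ab dF) => [|x /abU]; last exact: smooth_continuous.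
have w0 x : x \notin `]a, b[ -> w x = 0.
  by move=> /(compact_support_near0 scw) /nbhs_singleton.
have -> : w b = 0 by apply: w0; rewrite in_itv /= ltxx andbF.
have -> : w a = 0 by apply: w0; rewrite in_itv /= ltxx.
by rewrite dotv0r subrr.
Qed.

Lemma ode_multiplier (R : realType) m (a b : R) (gamma : R -> 'cV[R]_m.+1)
    (rho Lambda : R -> R) (N : R -> 'M[R]_(m.+1, m)) (kappa : R -> 'cV[R]_m)
    (U : set R) :
  a < b -> open U -> `[a, b] `<=` U -> smooth U rho -> smooth U kappa ->
  smooth U Lambda ->
  arclength_parametrized a b gamma -> parallel_frame a b gamma N ->
  curvature_function a b gamma N kappa ->
  (forall x, x \in `]a, b[ ->
      0 = derive1 (derive1 (fun y => rho y *: kappa y)) x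
          + (2^-1 * rho x * dotv (kappa x) (kappa x)) *: kappa x
          - Lambda x *: kappa x
      /\
      0 = derive1 Lambda x + 2^-1 * derive1 rho x * dotv (kappa x) (kappa x)) ->
  exists c, forall x, x \in `]a, b[ -> perp (derive1 gamma x)
    (derive1 (fun y => rho y *: derive1 (derive1 gamma) y) x - c) = 0.
Proof.
move=> ab oU abU sr sk sL hg hN hk ode.
set rk := fun y => rho y *: kappa y in ode *.
have srk : smooth U rk by exact: smooth_scalemx.
pose f x := Lambda x - 2^-1 * rho x * dotv (kappa x) (kappa x).
pose c x := N x *m derive1 rk x + f x *: derive1 gamma x.
have dc x : x \in `]a, b[ -> is_derive x 1 c 0.
  move=> xin; have Ux := abU _ (subset_itv_oo_cc xin).
  have [dT dN] := frame_derive hg hN hk xin; have [eq1 eq2] := ode x xin.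
  have dr := smooth_is_derive sr Ux; have dk := smooth_is_derive sk Ux.
  have drk := smooth_is_derive (smooth_derive1 srk) Ux.
  have df := is_derive1B (smooth_is_derive sL Ux)
    (is_derive1M (is_derive1M (@is_derive_cst R R R 2^-1 x 1) dr)
      (is_derive_dotv dk dk)).
  have := is_derive1D (is_derive_mulmx dN drk) (is_derive_scalemx df dT).
  (* The derivative of [c] has normal part N ((rho kappa)'' - f kappa), zero by the first equation,
     and tangential coefficient <kappa, (rho kappa)'> + f', zero by the second. *)
  congr is_derive.
  have -> : derive1 (derive1 rk) x = f x *: kappa x.
    apply/eqP; rewrite /f scalerBl -subr_eq0 opprB addrA; apply/eqP.
    by rewrite [RHS]eq1.
  rewrite mulmx_dotv -scalemxAr scalerN addrA addrAC addrK -scalerDl.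
  rewrite (derive1_val (is_derive_scalemx dr dk)) dotvDr !dotvZr.
  rewrite (_ : derive1 Lambda x =
    - (2^-1 * derive1 rho x * dotv (kappa x) (kappa x))); last first.
    by apply/eqP; rewrite -addr_eq0 -eq2.
  rewrite [dotv (derive1 kappa x) _]dotvC mul0r add0r.
  have F (p r' r q : R) : r' * q + r * p + (- (2^-1 * r' * q) -
      (2^-1 * r' * q + 2^-1 * r * (p + p))) = 0 by field.
  by rewrite F scale0r.
(* The derivative of [c] is known in the interior only, so the reference point is the midpoint
   rather than an endpoint. *)
pose x1 := (a + b) / 2.
have x1in : x1 \in `]a, b[ by rewrite in_itv /= !midf_lt.
have cE x : x \in `]a, b[ -> c x = c x1.
  have le u v : u \in `]a, b[ -> v \in `]a, b[ -> u <= v -> c u = c v.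
    move=> uin vin uv; apply/matrixP => i j.
    have dcij y : y \in `[u, v] -> is_derive y 1 (fun x => c x i j) 0.
      move=> yin; have yab : y \in `]a, b[.
        move: uin vin yin; rewrite !in_itv /=.
        move=> /andP[au _] /andP[_ vb] /andP[uy yv].
        by rewrite (lt_le_trans au) // (le_lt_trans yv).
      by have /is_derive_mxP /(_ i j) := dc y yab; rewrite mxE.
    exact: (eq_derive_cc uv dcij).
  move=> xin; have [xx1|x1x] := leP x x1; first exact: le.
  by apply/esym/le => //; exact: ltW.
(* The normal part of V is - N (rho kappa)', so the multiplier is minus the conserved vector. *)
exists (- c x1) => x xin; have xab := subset_itv_oo_cc xin.
have drk : derivable rk x 1 by have [] := smooth_is_derive srk (abU _ xab).
rewrite (force_derive hg hN hk xin drk) -/rk -(cE x xin) /c opprK.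
have F (A B C : 'cV[R]_m.+1) : - (A + B) + (B + C) = C - A.
  by rewrite opprD -addrA addKr addrC.
by rewrite F -scalerBl /perp dotvZl (enorm1 (hg.2 x xab)) mulr1 subrr.
Qed.

(* The ambient dimension n >= 2 is written m.+2. *)
Theorem theorem4p4 (R : realType) (m : nat) (a b : R) (hab : a < b)
    (gamma : R -> 'cV[R]_m.+2) (rho : R -> R)
    (hgamma : arclength_parametrized a b gamma)
    (hrho : stiffness a b rho)
    (N : R -> 'M[R]_(m.+2, m.+1)) (hN : parallel_frame a b gamma N)
    (kappa : R -> 'cV[R]_m.+1) (hkappa : curvature_function a b gamma N kappa) :
  elastic a b rho gamma <->
  exists2 Lambda : R -> R, smooth_on `[a, b] Lambda &
    forall x, x \in `[a, b] ->
      0 = derive1n 2 (fun y => rho y *: kappa y) x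
          + (2^-1 * rho x * dotv (kappa x) (kappa x)) *: kappa x
          - Lambda x *: kappa x
      /\
      0 = derive1 Lambda x + 2^-1 * derive1 rho x * dotv (kappa x) (kappa x).
Proof.
have [[[Ug [oUg abUg /Smooth sg]] _] _] := hgamma.
have [[Ur [oUr abUr /Smooth sr]] _] := hrho.
have [[Uk [oUk abUk /Smooth sk]] _] := hkappa.
rewrite elastic_multiplier //.
split=> [[c hc]|[Lambda [UL [oUL abUL /Smooth sL]] ode]].
  pose U := Ug `&` (Ur `&` Uk).
  have oU : open U by apply: openI => //; exact: openI.
  have abU : `[a, b] `<=` U.
    by move=> x xin; split; [exact: abUg|split; [exact: abUr|exact: abUk]].
  have [||| Lambda [sL] ode] := @multiplier_ode R m.+1 a b gamma rho N kappa U c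
    hab oU abU _ _ _ hgamma hN hkappa hc.
  - by apply: smooth_sub sg => x [].
  - by apply: smooth_sub sr => x [_ []].
  - by apply: smooth_sub sk => x [_ []].
  by exists Lambda => //; exists U.
pose U := UL `&` (Ur `&` Uk).
have oU : open U by apply: openI => //; exact: openI.
have abU : `[a, b] `<=` U.
  by move=> x xin; split; [exact: abUL|split; [exact: abUr|exact: abUk]].
apply: (@ode_multiplier R m.+1 a b gamma rho Lambda N kappa U) => //.
- by apply: smooth_sub sr => x [_ []].
- by apply: smooth_sub sk => x [_ []].
- by apply: smooth_sub sL => x [].
by move=> x /subset_itv_oo_cc; exact: ode.
Qed.
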